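(* Let $\alpha\in(0,1)$, let $p\ge2$ be an integer, $n(x)=x^p$, and let $k\ge1$ be an integer. Let $s\mapsto(\varphi_k(s),c_k(s))$ be the local analytic curve of nontrivial (for $s\ne0$) $2\pi/k$-periodic even zero-mean solutions of the steady equation bifurcating from $(0,k^{-\alpha})$, parametrised so that $s\mapsto c_k(s)$ is even. Then, as $s\to0$, $$\varphi_k(s)(x)=s\cos kx+s^p\,\Phi_k(x)+\mathcal{O}(s^{2p-1}),$$ where $\Phi_k=\Phi_k^{\mathrm{even}}$ if $p$ is even and $\Phi_k=\Phi_k^{\mathrm{odd}}$ if $p$ is odd, with corresponding speed $$c_k(s)=k^{-\alpha}+s^{2p-2}\,C_k^{\mathrm{even}}+\mathcal{O}(s^{2p})\quad(p\text{ even}),\qquad c_k(s)=k^{-\alpha}+s^{p-1}\,C_k^{\mathrm{odd}}+\mathcal{O}(s^{2p-2})\quad(p\text{ odd}).$$ Here, with $$C_{k,j}:=\frac{\binom{p}{j}/2^{p-1}}{k^{-\alpha}-((p-2j)k)^{-\alpha}},\qquad \Phi_{k,j}(x):=C_{k,j}\cos\bigl((p-2j)kx\bigr),$$ one has $$\Phi_k^{\mathrm{even}}:=\sum_{j=0}^{\frac p2-1}\Phi_{k,j},\qquad C_k^{\mathrm{even}}:=\frac{p}{2^{p-1}}\Bigl(C_{k,0}+\sum_{j=1}^{\frac p2-1}\Bigl(\tbinom{p-1}{j}+\tbinom{p-1}{j-1}\Bigr)C_{k,j}\Bigr),$$ $$\Phi_k^{\mathrm{odd}}:=\sum_{j=0}^{\frac{p-3}2}\Phi_{k,j},\qquad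 C_k^{\mathrm{odd}}:=\frac1{2^{p-1}}\binom{p}{\frac{p-1}{2}}.$$
   Context: $\mathbb{T}=\mathbb{R}/2\pi\mathbb{Z}$. For zero-mean $\varphi$ on $\mathbb{T}$, $|\mathrm{D}|^{-\alpha}\varphi$ is the zero-mean function with Fourier coefficients $|k|^{-\alpha}\widehat\varphi(k)$, $k\neq0$. The steady equation is $$F(\varphi,c):=|\mathrm{D}|^{-\alpha}\varphi-c\varphi+n(\varphi)-\frac1{2\pi}\int_{\mathbb{T}}n(\varphi(y))\,dy=0 .$$ Fix $\beta\in(\max\{\alpha,\frac12\},1)$ and let $\mathcal{X}^\beta$ be the space of even, zero-mean, $\beta$-Hölder continuous functions on $\mathbb{T}$. For smooth $n(x)=x^p$ the map $F$ is analytic $\mathcal{X}^\beta\times[0,\infty)\to\mathcal{X}^\beta$, and by the analytic Crandall–Rabinowitz theorem there is, for every integer $k\ge1$, a local analytic curve $s\mapsto(\varphi_k(s),c_k(s))\in\mathcal{X}^\beta\times[0,\infty)$ around $s=0$ of $2\pi/k$-periodic solutions of $F=0$, nontrivial for $s\ne0$, with $(\varphi_k(0),c_k(0))=(0,k^{-\alpha})$; near $(0,k^{-\alpha})$ these are all the nontrivial solutions that are even, zero-mean and in $C^\beta(\mathbb{T})$. The parametrisation making $c_k$ even is the one for which the $\cos(kx)$-coefficient $\frac1\pi\int_{\mathbb{T}}\varphi_k(s)(x)\cos(kx)\,dx$ equals $s$. The $\mathcal{O}$-terms for $\varphi_k$ are in the norm of $\mathcal{X}^\beta$. *)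

(* Defs.v *)
From Stdlib Require Import Reals ZArith.
From Coquelicot Require Import Coquelicot.
Open Scope R_scope.

(** Functions on [T = R / 2 pi Z] are represented by [2 pi]-periodic functions
    [R -> R]. *)

Definition periodic (L : R) (f : R -> R) : Prop := forall x, f (x + L) = f x.

Definition even_fun (f : R -> R) : Prop := forall x, f (- x) = f x.

Definition mean (f : R -> R) : R := / (2 * PI) * RInt f (- PI) PI.

(** [1 / (2 pi) * int_T f(x) exp(-i m x) dx], by real and imaginary parts. *)
Definition fourier_coeff (f : R -> R) (m : Z) : C :=
  (mean (fun x => f x * cos (IZR m * x)),
   - mean (fun x => f x * sin (IZR m * x))).

(** Since [f] is periodic, the Hölder quotients over pairs of distinct reals
    have the same supremum as those for the distance of [T]. *)
Definition holder_quotient (beta : R) (f : R -> R) (q : R) : Prop :=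
  exists x y, x <> y /\ q = Rabs (f x - f y) / Rpower (Rabs (x - y)) beta.

Definition holder_seminorm (beta : R) (f : R -> R) : Rbar :=
  Lub_Rbar (holder_quotient beta f).

Definition sup_norm (f : R -> R) : Rbar :=
  Lub_Rbar (fun q => exists x, q = Rabs (f x)).

(** Both suprema are over nonempty sets of nonnegative numbers, so the norm
    is in [[0, +oo]]. *)
Definition holder_norm (beta : R) (f : R -> R) : Rbar :=
  Rbar_plus (sup_norm f) (holder_seminorm beta f).

Record in_X (beta : R) (f : R -> R) : Prop := {
  in_X_periodic : periodic (2 * PI) f;
  in_X_even : even_fun f;
  in_X_holder : is_finite (holder_norm beta f);
  in_X_mean : mean f = 0
}.

(** [psi = |D|^{-alpha} phi].  Continuity makes [psi] unique as a function,
    and not just almost everywhere. *)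
Record is_inv_D (alpha : R) (phi psi : R -> R) : Prop := {
  inv_D_continuous : forall x, continuous psi x;
  inv_D_periodic : periodic (2 * PI) psi;
  inv_D_mean : mean psi = 0;
  inv_D_fourier : forall m : Z, m <> 0%Z ->
    fourier_coeff psi m =
      Cmult (RtoC (Rpower (IZR (Z.abs m)) (- alpha))) (fourier_coeff phi m)
}.

Definition steady_solution (alpha : R) (n : R -> R) (phi : R -> R) (c : R)
    : Prop :=
  exists psi, is_inv_D alpha phi psi /\
    forall x, psi x - c * phi x + n (phi x) - mean (fun y => n (phi y)) = 0.

(** Real analyticity of a curve in the Banach space [X^beta], on
    [(-eps, eps)]: near every point it is the sum of a power series with
    coefficients in [X^beta], convergent in norm. *)
Definition analytic_in_X (beta eps : R) (phi : R -> R -> R) : Prop :=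
  forall s0, Rabs s0 < eps ->
  exists a : nat -> R -> R, (forall j, in_X beta (a j)) /\
  exists r, 0 < r /\
  forall s, Rabs (s - s0) < r -> Rabs s < eps ->
  forall e, 0 < e -> exists N : nat, forall n : nat, (N <= n)%nat ->
    Rbar_le (holder_norm beta
      (fun x => phi s x - sum_n (fun j => (s - s0) ^ j * a j x) n)) e.

Definition analytic_real (eps : R) (c : R -> R) : Prop :=
  forall s0, Rabs s0 < eps ->
  exists a : nat -> R, exists r, 0 < r /\
  forall s, Rabs (s - s0) < r -> Rabs s < eps -> is_pseries a (s - s0) (c s).

(** The local curve of solutions through [(0, k^{-alpha})], for [|s| < eps].
    [curve_coeff] selects, among the parametrisations with [c] even, the one
    by the [cos (k x)]-coefficient. *)
Record bifurcation_curve (alpha beta : R) (n : R -> R) (k : nat) (eps : R)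
    (phi : R -> R -> R) (c : R -> R) : Prop := {
  curve_phi_analytic : analytic_in_X beta eps phi;
  curve_c_analytic : analytic_real eps c;
  curve_in_X : forall s, Rabs s < eps -> in_X beta (phi s);
  curve_c_ge0 : forall s, Rabs s < eps -> 0 <= c s;
  curve_phi_0 : forall x, phi 0 x = 0;
  curve_c_0 : c 0 = Rpower (INR k) (- alpha);
  curve_solution : forall s, Rabs s < eps ->
    steady_solution alpha n (phi s) (c s);
  curve_periodic : forall s, Rabs s < eps -> periodic (2 * PI / INR k) (phi s);
  curve_nontrivial : forall s, Rabs s < eps -> s <> 0 ->
    exists x, phi s x <> 0;
  curve_c_even : forall s, Rabs s < eps -> c (- s) = c s;
  curve_coeff : forall s, Rabs s < eps ->
    / PI * RInt (fun x => phi s x * cos (INR k * x)) (- PI) PI = s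
}.

(** [N s = O(s^m)] as [s -> 0], for a size [N s] in [[0, +oo]]. *)
Definition bigO_at_0 (N : R -> Rbar) (m : nat) : Prop :=
  exists M : R, locally 0 (fun s => Rbar_le (N s) (M * Rabs s ^ m)).

(** [Binomial.C] is the binomial coefficient; the bare name [C] is the type of
    complex numbers.  All the natural number subtractions below are used only
    with nonnegative results, and [sum_n_m f a b] is [0] when [b < a]. *)
Definition coef_C (alpha : R) (p k j : nat) : R :=
  (Binomial.C p j / 2 ^ (p - 1)) /
  (Rpower (INR k) (- alpha) - Rpower (INR ((p - 2 * j) * k)) (- alpha)).

Definition coef_Phi (alpha : R) (p k j : nat) (x : R) : R :=
  coef_C alpha p k j * cos (INR ((p - 2 * j) * k) * x).

Definition Phi_even (alpha : R) (p k : nat) (x : R) : R :=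
  sum_n_m (fun j => coef_Phi alpha p k j x) 0 (p / 2 - 1).

Definition Phi_odd (alpha : R) (p k : nat) (x : R) : R :=
  sum_n_m (fun j => coef_Phi alpha p k j x) 0 ((p - 3) / 2).

Definition Phi (alpha : R) (p k : nat) : R -> R :=
  if Nat.even p then Phi_even alpha p k else Phi_odd alpha p k.

Definition C_even (alpha : R) (p k : nat) : R :=
  INR p / 2 ^ (p - 1) *
  (coef_C alpha p k 0 +
   sum_n_m (fun j => (Binomial.C (p - 1) j + Binomial.C (p - 1) (j - 1))
                     * coef_C alpha p k j) 1 (p / 2 - 1)).

(** This constant depends neither on [alpha] nor on [k]. *)
Definition C_odd (p : nat) : R := / 2 ^ (p - 1) * Binomial.C p ((p - 1) / 2).

(* Main.v *)
(** Near [s = 0] the curve is a power series [phi s = sum_j s^j a_j] in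
    [X^beta], and an element of [X^beta] is determined by its cosine
    coefficients.  So it is enough to expand these one at a time: a scalar
    asymptotic expansion of every coefficient up to order [d] identifies
    [a_0, ..., a_d], and the tail of the series then gives the error in the
    Hölder norm, with no bound on the inverse of the linearised operator.  The
    equation reads, in mode [m >= 1],
    [(m^-alpha - c) <phi, cos m> + <phi^p, cos m> = 0].  With [phi = O(s)] it
    gives [phi = s cos(kx) + O(s^p)]; inserting this in [phi^p] gives [c] up to
    [O(s^(2p-2))] from the mode [k] and [phi] up to [O(s^(2p-1))] from the
    others.  For even [p] the [s^(p-1)] term of [c] vanishes and one expands
    [phi^p] to second order. *)

Require Import Defs.
From Stdlib Require Import Reals ZArith Lra Lia Classical.
From Coquelicot Require Import Coquelicot.
Open Scope R_scope.

(** * Hölder bounds and power series *)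

(** The constants of the coefficientwise estimates may depend on the mode [m]: they serve only to
    show that a polynomial in [s] of degree [d] which is [O(s^(d+1))] has zero coefficients. Two
    modes escape the division by [m^-alpha - c]. Mode 0 vanishes because the mean is zero, and mode
    [k] is exactly [s] by the parametrisation; the equation in mode [k] therefore determines [c], at
    the price of a division by [s], which turns an error [O(s^(2p-1))] in [phi^p] into [O(s^(2p-2))]
    in [c]. For even [p] the quadratic Taylor remainder of [phi^p] around [s cos(kx)] is [s^(p-2)]
    times the square of an [O(s^p)], so [c] is known up to [O(s^(3p-3))]. This is short of
    [O(s^(2p))] only for [p = 2], by one order, and there the parity of [c] supplies it. That cosine
    coefficients determine an even function is obtained by a peaking argument: a positive value of
    the function is detected by powers of a trigonometric polynomial that exceeds 1 only near that
    point. *)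

Definition holder_bound (beta : R) (f : R -> R) (M : R) : Prop :=
  (forall x, Rabs (f x) <= M) /\
  (forall x y, x <> y ->
    Rabs (f x - f y) <= M * Rpower (Rabs (x - y)) beta).

Lemma Rpower_pos (x y : R) : 0 < Rpower x y.
Proof. apply exp_pos. Qed.

Lemma holder_bound_ext (beta : R) (f g : R -> R) (M : R) :
  (forall x, f x = g x) -> holder_bound beta f M -> holder_bound beta g M.
Proof.
intros E [H1 H2]; split; intros; rewrite <- !E; auto.
Qed.

Lemma holder_bound_weaken (beta : R) (f : R -> R) (M N : R) :
  M <= N -> holder_bound beta f M -> holder_bound beta f N.
Proof.
intros L [H1 H2]; split; intros.
- specialize (H1 x); lra.
- specialize (H2 x y H).
  pose proof (Rpower_pos (Rabs (x - y)) beta); nra.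
Qed.

Lemma holder_bound_conv (beta : R) (f g : R -> R) (M N : R) :
  (forall x, f x = g x) -> M <= N ->
  holder_bound beta f M -> holder_bound beta g N.
Proof.
intros E L H; apply holder_bound_weaken with M; [assumption|].
now apply holder_bound_ext with f.
Qed.

Lemma holder_bound_ge0 (beta : R) (f : R -> R) (M : R) :
  holder_bound beta f M -> 0 <= M.
Proof. intros [H _]; specialize (H 0); pose proof (Rabs_pos (f 0)); lra. Qed.

Lemma holder_bound_plus (beta : R) (f g : R -> R) (M N : R) :
  holder_bound beta f M -> holder_bound beta g N ->
  holder_bound beta (fun x => f x + g x) (M + N).
Proof.
intros [F1 F2] [G1 G2]; split; intros.
- eapply Rle_trans; [apply Rabs_triang|]; specialize (F1 x); specialize (G1 x); lra.
- replace (f x + g x - (f y + g y)) with ((f x - f y) + (g x - g y)) by ring.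
  eapply Rle_trans; [apply Rabs_triang|].
  specialize (F2 x y H); specialize (G2 x y H); lra.
Qed.

Lemma holder_bound_scal (beta c : R) (f : R -> R) (M : R) :
  holder_bound beta f M -> holder_bound beta (fun x => c * f x) (Rabs c * M).
Proof.
intros [F1 F2]; split; intros.
- rewrite Rabs_mult; apply Rmult_le_compat_l; [apply Rabs_pos|auto].
- replace (c * f x - c * f y) with (c * (f x - f y)) by ring.
  rewrite Rabs_mult, Rmult_assoc.
  apply Rmult_le_compat_l; [apply Rabs_pos|auto].
Qed.

Lemma holder_bound_minus (beta : R) (f g : R -> R) (M N : R) :
  holder_bound beta f M -> holder_bound beta g N ->
  holder_bound beta (fun x => f x - g x) (M + N).
Proof.
intros F G.
apply (holder_bound_scal beta (-1)) in G.
replace (Rabs (-1)) with 1 in G by (rewrite Rabs_left; lra).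
rewrite Rmult_1_l in G.
generalize (holder_bound_plus _ _ _ _ _ F G); apply holder_bound_ext.
intros; ring.
Qed.

(** Lets an arbitrarily small remainder be discarded when partial sums are replaced by the sum of a
    series. *)
Lemma holder_bound_lim (beta : R) (f : R -> R) (M : R) :
  (forall e, 0 < e -> holder_bound beta f (M + e)) -> holder_bound beta f M.
Proof.
intros H; split; intros.
- apply le_epsilon; intros e He; now apply (H e He).
- apply le_epsilon; intros e He.
  pose proof (Rpower_pos (Rabs (x - y)) beta) as P.
  assert (He' : 0 < e / Rpower (Rabs (x - y)) beta) by now apply Rdiv_lt_0_compat.
  destruct (H _ He') as [_ H2].
  specialize (H2 x y H0).
  rewrite Rmult_plus_distr_r in H2.
  replace (e / Rpower (Rabs (x - y)) beta * Rpower (Rabs (x - y)) beta)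
    with e in H2 by (field; lra).
  exact H2.
Qed.

Lemma sup_norm_ub (f : R -> R) (x : R) : Rbar_le (Rabs (f x)) (sup_norm f).
Proof.
unfold sup_norm.
destruct (Lub_Rbar_correct (fun q => exists x, q = Rabs (f x))) as [U _].
apply U; now exists x.
Qed.

Lemma holder_seminorm_ub (beta : R) (f : R -> R) (x y : R) : x <> y ->
  Rbar_le (Rabs (f x - f y) / Rpower (Rabs (x - y)) beta)
    (holder_seminorm beta f).
Proof.
intros N; unfold holder_seminorm.
destruct (Lub_Rbar_correct (holder_quotient beta f)) as [U _].
apply U; now exists x, y.
Qed.

Lemma holder_norm_bound (beta : R) (f : R -> R) (M : R) :
  Rbar_le (holder_norm beta f) M -> holder_bound beta f M.
Proof.
unfold holder_norm; intros H.
pose proof (sup_norm_ub f) as A; pose proof (holder_seminorm_ub beta f) as B.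
assert (Q : forall x y, 0 <= Rabs (f x - f y) / Rpower (Rabs (x - y)) beta).
{ intros; apply Rdiv_le_0_compat; [apply Rabs_pos|apply Rpower_pos]. }
(* [Rbar_plus] gives opposite infinities the default sum 0, so [m_infty] has to be excluded by hand:
   both suprema are over nonempty sets. *)
destruct (sup_norm f) as [a| |]; destruct (holder_seminorm beta f) as [b| |];
  simpl in *; try tauto;
  try (specialize (A 0); tauto); try (assert (N : 0 <> 1) by lra; specialize (B 0 1 N); tauto).
assert (a0 : 0 <= a).
{ eapply Rle_trans; [apply (Rabs_pos (f 0))|apply A]. }
assert (b0 : 0 <= b).
{ eapply Rle_trans; [apply (Q 0 1)|apply B; lra]. }
split; intros.
- specialize (A x); lra.
- specialize (B x y H0).
  pose proof (Rpower_pos (Rabs (x - y)) beta) as P.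
  apply (Rmult_le_compat_r (Rpower (Rabs (x - y)) beta)) in B; [|lra].
  replace (Rabs (f x - f y) / Rpower (Rabs (x - y)) beta
    * Rpower (Rabs (x - y)) beta) with (Rabs (f x - f y)) in B by (field; lra).
  nra.
Qed.

(** The factor 2 appears because [holder_bound] bounds the supremum and the seminorm by the same
    constant, while the norm adds them. *)
Lemma holder_norm_le (beta : R) (f : R -> R) (M : R) :
  holder_bound beta f M -> Rbar_le (holder_norm beta f) (2 * M).
Proof.
intros [H1 H2].
assert (A : Rbar_le (sup_norm f) M).
{ unfold sup_norm.
  destruct (Lub_Rbar_correct (fun q => exists x, q = Rabs (f x))) as [_ U].
  apply U; intros q [x ->]; apply H1. }
assert (B : Rbar_le (holder_seminorm beta f) M).
{ unfold holder_seminorm.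
  destruct (Lub_Rbar_correct (holder_quotient beta f)) as [_ U].
  apply U; intros q [x [y [N ->]]]; simpl.
  pose proof (Rpower_pos (Rabs (x - y)) beta) as P.
  apply Rmult_le_reg_r with (Rpower (Rabs (x - y)) beta); [lra|].
  replace (Rabs (f x - f y) / Rpower (Rabs (x - y)) beta
    * Rpower (Rabs (x - y)) beta) with (Rabs (f x - f y)) by (field; lra).
  now apply H2. }
unfold holder_norm.
replace (Finite (2 * M)) with (Rbar_plus M M) by (simpl; f_equal; ring).
now apply Rbar_plus_le_compat.
Qed.

Lemma holder_bound_continuous (beta : R) (f : R -> R) (M : R) :
  0 < beta -> holder_bound beta f M -> forall x, continuous f x.
Proof.
intros Hb H x.
pose proof (holder_bound_ge0 _ _ _ H) as M0.
destruct H as [_ H].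
apply filterlim_locally; intros eps.
assert (P : 0 < eps / (M + 1)).
{ apply Rdiv_lt_0_compat; [apply cond_pos|lra]. }
exists (mkposreal _ (Rpower_pos (eps / (M + 1)) (/ beta))).
intros y Hy.
change (Rabs (y - x) < Rpower (eps / (M + 1)) (/ beta)) in Hy.
change (Rabs (f y - f x) < eps).
(* [Rpower 0 beta] is 1, since [ln 0] is 0 by default, so the diagonal is treated apart. *)
destruct (Req_dec y x) as [->|N].
{ rewrite Rminus_diag, Rabs_R0; apply cond_pos. }
eapply Rle_lt_trans; [now apply H|].
assert (L : Rpower (Rabs (y - x)) beta < eps / (M + 1)).
{ replace (eps / (M + 1)) with (Rpower (Rpower (eps / (M + 1)) (/ beta)) beta).
  - apply Rlt_Rpower_l; [lra|split; [apply Rabs_pos_lt; lra|assumption]].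
  - rewrite Rpower_mult, Rinv_l, Rpower_1; lra. }
pose proof (Rpower_pos (Rabs (y - x)) beta).
apply Rle_lt_trans with ((M + 1) * Rpower (Rabs (y - x)) beta); [nra|].
replace (pos eps) with ((M + 1) * (eps / (M + 1))) by (field; lra).
apply Rmult_lt_compat_l; lra.
Qed.

Lemma in_X_bound (beta : R) (f : R -> R) :
  in_X beta f -> exists M, holder_bound beta f M.
Proof.
intros [_ _ F _].
exists (real (holder_norm beta f)).
apply holder_norm_bound; rewrite F; apply Rbar_le_refl.
Qed.

Lemma in_X_continuous (beta : R) (f : R -> R) :
  0 < beta -> in_X beta f -> forall x, continuous f x.
Proof.
intros Hb HX; destruct (in_X_bound _ _ HX) as [M HM].
now apply holder_bound_continuous with beta M.
Qed.

Lemma sum_n_S (u : nat -> R) (n : nat) : sum_n u (S n) = sum_n u n + u (S n).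
Proof. exact (sum_Sn u n). Qed.

Lemma sum_n_Rminus (u v : nat -> R) (n : nat) :
  sum_n (fun j => u j - v j) n = sum_n u n - sum_n v n.
Proof.
induction n as [|n IH]; [now rewrite !sum_O|].
rewrite !sum_n_S, IH; apply Rminus_diag_uniq; ring.
Qed.

Lemma holder_bound_unif (beta : R) (a : nat -> R -> R) (N : nat) :
  (forall j, exists M, holder_bound beta (a j) M) ->
  exists M, forall j, (j <= N)%nat -> holder_bound beta (a j) M.
Proof.
intros H; induction N as [|N [M IH]].
- destruct (H 0%nat) as [M HM]; exists M; intros j Hj.
  now replace j with 0%nat by lia.
- destruct (H (S N)) as [M' HM']; exists (Rmax M M'); intros j Hj.
  destruct (Nat.eq_dec j (S N)) as [->|Nj].
  + apply holder_bound_weaken with M'; [apply Rmax_r|assumption].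
  + apply holder_bound_weaken with M; [apply Rmax_l|apply IH; lia].
Qed.

(** The subtracted last term makes the induction close: [x ^ n <= 2 * x ^ n - 2 * x ^ S n] when
    [x <= 1 / 2]. *)
Lemma geom_sum_tail (x : R) (d m : nat) : 0 <= x <= 1 / 2 ->
  forall u : nat -> R, (forall j, u j = x ^ j) ->
  sum_n u (d + m) - sum_n u d <= 2 * x ^ S d - 2 * x ^ S (d + m).
Proof.
intros Hx u Hu; induction m as [|m IH].
- rewrite Nat.add_0_r.
  assert (0 <= x ^ S d) by (apply pow_le; lra). lra.
- rewrite Nat.add_succ_r, sum_n_S, Hu.
  assert (0 <= x ^ S (d + m)) by (apply pow_le; lra).
  replace (x ^ S (S (d + m))) with (x * x ^ S (d + m)) by reflexivity.
  nra.
Qed.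

(* Convergence at one point [s1 > 0] bounds [a j * s1 ^ j], so that the series
   is dominated by a geometric one for [|s| <= s1 / 2]. *)
Lemma power_series_tail (beta rho : R) (F : R -> R -> R) (a : nat -> R -> R) :
  0 < rho -> (forall j, exists M, holder_bound beta (a j) M) ->
  (forall s, Rabs s < rho -> forall e, 0 < e ->
    exists N : nat, forall n, (N <= n)%nat ->
    holder_bound beta (fun x => F s x - sum_n (fun j => s ^ j * a j x) n) e) ->
  forall d, exists M, locally 0 (fun s =>
    holder_bound beta (fun x => F s x - sum_n (fun j => s ^ j * a j x) d)
      (M * Rabs s ^ S d)).
Proof.
intros Hrho Ha HF d.
set (s1 := rho / 2).
assert (Hs1 : 0 < s1 < rho) by (unfold s1; lra).
assert (B : exists M, forall j, holder_bound beta (a j) (M / s1 ^ j)).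
{ destruct (HF s1 ltac:(rewrite Rabs_right; lra) 1 Rlt_0_1) as [N HN].
  destruct (holder_bound_unif beta (fun j x => s1 ^ j * a j x) N) as [M HM].
  { intros j; destruct (Ha j) as [M HM]; eexists; apply holder_bound_scal, HM. }
  (* Up to [N] a finite maximum serves; beyond [N] the term is a difference of two successive
     remainders of size at most 1, hence the 2. *)
  exists (Rmax M 2); intros j.
  assert (P : 0 < s1 ^ j) by (apply pow_lt; lra).
  assert (Q : holder_bound beta (fun x => s1 ^ j * a j x) (Rmax M 2)).
  { destruct (le_lt_dec j N) as [L|L].
    - apply holder_bound_weaken with M; [apply Rmax_l|now apply HM].
    - apply holder_bound_weaken with (1 + 1); [etransitivity; [|apply Rmax_r]; lra|].
      destruct j as [|j]; [lia|].
      generalize (holder_bound_minus _ _ _ _ _ (HN j ltac:(lia)) (HN (S j) ltac:(lia))).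
      apply holder_bound_ext; intros x; rewrite sum_n_S; ring. }
  apply (holder_bound_scal beta (/ s1 ^ j)) in Q.
  rewrite Rabs_right in Q by (apply Rle_ge, Rlt_le, Rinv_0_lt_compat; assumption).
  generalize Q; unfold Rdiv; rewrite Rmult_comm.
  apply holder_bound_ext; intros x; field; lra. }
destruct B as [M HM].
assert (M0 : 0 <= M).
{ generalize (holder_bound_ge0 _ _ _ (HM 0%nat)); simpl; lra. }
assert (T : forall s m, Rabs s <= s1 / 2 -> holder_bound beta
    (fun x => sum_n (fun j => s ^ j * a j x) (d + m)
      - sum_n (fun j => s ^ j * a j x) d)
    (M * (sum_n (fun j => (Rabs s / s1) ^ j) (d + m)
      - sum_n (fun j => (Rabs s / s1) ^ j) d))).
{ intros s m Hs; induction m as [|m IH].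
  - rewrite Nat.add_0_r; apply holder_bound_weaken with (Rabs 0 * (M / s1 ^ 0)).
    { rewrite Rabs_R0; lra. }
    generalize (holder_bound_scal _ 0 _ _ (HM 0%nat)).
    apply holder_bound_ext; intros; ring.
  - rewrite Nat.add_succ_r.
    generalize (holder_bound_plus _ _ _ _ _ IH
      (holder_bound_scal _ (s ^ S (d + m)) _ _ (HM (S (d + m))))).
    apply holder_bound_conv; [intros x; rewrite sum_n_S; ring|].
    right; rewrite sum_n_S.
    rewrite <- RPow_abs; unfold Rdiv; rewrite Rpow_mult_distr, pow_inv.
    ring. }
(* With ratio [|s| / s1 <= 1 / 2], the tail is at most twice its first term
   [M * (|s| / s1) ^ S d]. *)
exists (M * (2 / s1 ^ S d)).
exists (mkposreal (s1 / 2) ltac:(lra)); intros s Hs.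
change (Rabs (s - 0) < s1 / 2) in Hs; rewrite Rminus_0_r in Hs.
assert (X : 0 <= Rabs s / s1 <= 1 / 2).
{ split; [apply Rdiv_le_0_compat; [apply Rabs_pos|lra]|].
  apply Rmult_le_reg_r with s1; [lra|].
  replace (Rabs s / s1 * s1) with (Rabs s) by (field; lra). lra. }
apply holder_bound_lim; intros e He.
destruct (HF s ltac:(lra) e He) as [N HN].
generalize (holder_bound_plus _ _ _ _ _ (T s N ltac:(lra)) (HN (d + N)%nat ltac:(lia))).
apply holder_bound_conv; [intros x; ring|].
apply Rplus_le_compat_r.
rewrite Rmult_assoc; apply Rmult_le_compat_l; [assumption|].
eapply Rle_trans; [now apply (geom_sum_tail (Rabs s / s1) d N)|].
assert (0 <= (Rabs s / s1) ^ S (d + N)) by (apply pow_le; lra).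
replace (2 / s1 ^ S d * Rabs s ^ S d) with (2 * (Rabs s / s1) ^ S d).
2:{ unfold Rdiv at 1; rewrite Rpow_mult_distr, pow_inv; field; apply pow_nonzero; lra. }
lra.
Qed.

(** * Cosine coefficients *)

Definition continuous_fun (f : R -> R) : Prop := forall x, continuous f x.

Lemma continuous_fun_const (c : R) : continuous_fun (fun _ => c).
Proof. intros x; apply continuous_const. Qed.

Lemma continuous_fun_plus (f g : R -> R) :
  continuous_fun f -> continuous_fun g -> continuous_fun (fun x => f x + g x).
Proof. intros F G x; exact (continuous_plus f g x (F x) (G x)). Qed.

Lemma continuous_fun_mult (f g : R -> R) :
  continuous_fun f -> continuous_fun g -> continuous_fun (fun x => f x * g x).
Proof. intros F G x; exact (continuous_mult f g x (F x) (G x)). Qed.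

Lemma continuous_fun_minus (f g : R -> R) :
  continuous_fun f -> continuous_fun g -> continuous_fun (fun x => f x - g x).
Proof. intros F G x; exact (continuous_minus f g x (F x) (G x)). Qed.

Lemma continuous_fun_pow (f : R -> R) (n : nat) :
  continuous_fun f -> continuous_fun (fun x => f x ^ n).
Proof.
intros F; induction n as [|n IH].
- exact (continuous_fun_const 1).
- now apply (continuous_fun_mult f (fun x => f x ^ n)).
Qed.

Lemma continuous_fun_affine_cos (a b : R) :
  continuous_fun (fun x => cos (a * x + b)).
Proof.
intros x; apply (ex_derive_continuous (fun x => cos (a * x + b))); auto_derive; easy.
Qed.

Lemma continuous_fun_ext (f g : R -> R) :
  (forall x, f x = g x) -> continuous_fun f -> continuous_fun g.
Proof. intros E F x; now apply continuous_ext with f. Qed.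

Lemma continuous_fun_cos (a : R) : continuous_fun (fun x => cos (a * x)).
Proof.
apply continuous_fun_ext with (2 := continuous_fun_affine_cos a 0).
intros; now rewrite Rplus_0_r.
Qed.

Lemma continuous_fun_sin (a : R) : continuous_fun (fun x => sin (a * x)).
Proof.
intros x; apply (ex_derive_continuous (fun x => sin (a * x))); auto_derive; easy.
Qed.

Lemma continuous_fun_sum (u : nat -> R -> R) (n : nat) :
  (forall j, continuous_fun (u j)) -> continuous_fun (fun x => sum_n (fun j => u j x) n).
Proof.
intros H; induction n as [|n IH].
- apply continuous_fun_ext with (2 := H 0%nat); intros x; now rewrite sum_O.
- apply continuous_fun_ext with (2 := continuous_fun_plus _ _ IH (H (S n))).
  intros x; now rewrite sum_n_S.
Qed.

Lemma ex_RInt_cont (f : R -> R) (a b : R) : continuous_fun f -> ex_RInt f a b.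
Proof. intros F; apply (ex_RInt_continuous (V := R_CompleteNormedModule)); auto. Qed.

Lemma RInt_cont_plus (f g : R -> R) (a b : R) :
  continuous_fun f -> continuous_fun g ->
  RInt (fun x => f x + g x) a b = RInt f a b + RInt g a b.
Proof.
intros F G; exact (RInt_plus f g a b (ex_RInt_cont _ _ _ F) (ex_RInt_cont _ _ _ G)).
Qed.

Lemma RInt_cont_scal (f : R -> R) (a b c : R) :
  continuous_fun f -> RInt (fun x => c * f x) a b = c * RInt f a b.
Proof. intros F; exact (RInt_scal f a b c (ex_RInt_cont _ _ _ F)). Qed.

Lemma RInt_fun_ext (f g : R -> R) (a b : R) :
  (forall x, f x = g x) -> RInt f a b = RInt g a b.
Proof. intros E; apply RInt_ext; auto. Qed.

Lemma RInt_odd (f : R -> R) (a : R) :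
  continuous_fun f -> (forall x, f (- x) = - f x) -> RInt f (- a) a = 0.
Proof.
intros F O.
assert (E : RInt f (- a) a = RInt f a (- a)).
{ pose proof (RInt_comp_lin f (-1) 0 a (- a)) as L.
  replace (-1 * a + 0) with (- a) in L by ring.
  replace (-1 * - a + 0) with a in L by ring.
  rewrite <- L by now apply ex_RInt_cont.
  apply RInt_fun_ext; intros x; change (scal (-1) ?y) with (-1 * y).
  replace (-1 * x + 0) with (- x) by ring.
  rewrite O; ring. }
pose proof (opp_RInt_swap f (- a) a (ex_RInt_cont _ _ _ F)) as S.
change (- RInt f (- a) a = RInt f a (- a)) in S; lra.
Qed.

(** * Uniqueness of cosine coefficients *)

Section peak.
Variables (f : R -> R) (x0 delta h B : R).
Hypothesis (f_cont : continuous_fun f).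
Hypothesis (delta_pos : 0 < delta).
Hypothesis (x0_in : - PI + delta <= x0 <= PI - delta).
Hypothesis (h_pos : 0 < h).
Hypothesis (f_near : forall x, x0 - delta < x < x0 + delta -> h <= f x).
Hypothesis (f_bound : forall x, - PI <= x <= PI -> Rabs (f x) <= B).
Hypothesis (f_orth : forall (m : Z) (theta : R),
  RInt (fun x => f x * cos (IZR m * x + theta)) (- PI) PI = 0).

(** On [[-PI, PI]], [u] is positive exactly within [delta] of [x0]. There [1 + u] exceeds 1;
    elsewhere it stays in [[-1, 1]]. *)
Let u (x : R) := cos (x - x0) - cos delta.
Let pospart (x : R) := (u x + Rabs (u x)) / 2.

Lemma peak_cont : continuous_fun u.
Proof.
apply continuous_fun_minus; [|apply continuous_fun_const].
apply continuous_fun_ext with (2 := continuous_fun_affine_cos 1 (- x0)).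
intros; f_equal; ring.
Qed.

(** Multiplying by [cos (x - x0)] shifts the frequency by 1 and the phase by [x0], in both
    directions; the induction therefore needs all integers [m] and all phases [theta]. *)
Lemma peak_orth (n : nat) : forall (m : Z) (theta : R),
  RInt (fun x => f x * (1 + u x) ^ n * cos (IZR m * x + theta)) (- PI) PI = 0.
Proof.
pose proof peak_cont as U.
induction n as [|n IH]; intros m theta.
- rewrite <- (f_orth m theta); apply RInt_fun_ext; intros; simpl; ring.
- set (g := fun x => f x * (1 + u x) ^ n) in IH.
  assert (G : continuous_fun g).
  { apply continuous_fun_mult; [assumption|apply continuous_fun_pow].
    apply continuous_fun_plus; [apply continuous_fun_const|assumption]. }
  rewrite (RInt_fun_ext _ (fun x =>
    (1 - cos delta) * (g x * cos (IZR m * x + theta)) +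
    (1 / 2 * (g x * cos (IZR (m + 1) * x + (theta - x0))) +
     1 / 2 * (g x * cos (IZR (m - 1) * x + (theta + x0)))))).
  + assert (GC : forall a b c, continuous_fun (fun x => a * (g x * cos (b * x + c)))).
    { intros; apply continuous_fun_mult; [apply continuous_fun_const|].
      apply continuous_fun_mult; [assumption|apply continuous_fun_affine_cos]. }
    assert (GC' : forall b c, continuous_fun (fun x => g x * cos (b * x + c))).
    { intros; apply continuous_fun_mult; [assumption|apply continuous_fun_affine_cos]. }
    rewrite !RInt_cont_plus, !RInt_cont_scal, !IH by auto using continuous_fun_plus.
    apply Rminus_diag_uniq; ring.
  + intros x; unfold g, u; rewrite plus_IZR, minus_IZR; simpl.
    replace ((IZR m + 1) * x + (theta - x0)) with ((IZR m * x + theta) + (x - x0)) by ring.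
    replace ((IZR m - 1) * x + (theta + x0)) with ((IZR m * x + theta) - (x - x0)) by ring.
    generalize (IZR m * x + theta) (x - x0); intros a b.
    rewrite cos_plus, cos_minus; field.
Qed.

Lemma peak_near (x : R) : - PI <= x <= PI -> 0 < u x -> x0 - delta < x < x0 + delta.
Proof.
intros Hx Hu; unfold u in Hu.
assert (A : Rabs (x - x0) < delta).
{ apply Rnot_le_lt; intros L.
  assert (E : cos (x - x0) = cos (Rabs (x - x0))).
  { unfold Rabs; destruct Rcase_abs; [now rewrite cos_neg|reflexivity]. }
  (* As [x0] is at least [delta] away from the end points, a distance [y] beyond [PI] reflects to
     [2 * PI - y], which is still at least [delta]. *)
  assert (Y : Rabs (x - x0) <= 2 * PI - delta) by (apply Rabs_le; lra).
  rewrite E in Hu; set (y := Rabs (x - x0)) in *.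
  destruct (Rle_dec y PI) as [P|P].
  - assert (cos y <= cos delta); [apply cos_decr_1; lra|lra].
  - assert (cos y = cos (2 * PI - y)) as C.
    { rewrite <- (cos_neg y), <- (cos_period (- y) 1); f_equal; simpl; ring. }
    assert (cos (2 * PI - y) <= cos delta); [apply cos_decr_1; lra|lra]. }
apply Rabs_def2 in A; lra.
Qed.

Lemma peak_far (x : R) : u x <= 0 -> -1 <= 1 + u x <= 1.
Proof.
unfold u; intros Hu.
pose proof (COS_bound (x - x0)); pose proof (COS_bound delta); lra.
Qed.

Lemma peak_pospart_cont : continuous_fun pospart.
Proof.
pose proof peak_cont as U.
apply continuous_fun_mult; [|apply continuous_fun_const].
apply continuous_fun_plus; [assumption|].
intros x; apply continuous_Rabs_comp, U.
Qed.

Lemma peak_pospart_int : 0 < RInt pospart (- PI) PI.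
Proof.
pose proof peak_pospart_cont as P.
assert (P0 : forall x, 0 <= pospart x).
{ intros x; unfold pospart; pose proof (Rabs_maj2 (u x)); lra. }
rewrite <- (RInt_Chasles pospart _ (x0 - delta) _) by now apply ex_RInt_cont.
rewrite <- (RInt_Chasles pospart (x0 - delta) (x0 + delta) _) by now apply ex_RInt_cont.
change (0 < RInt pospart (- PI) (x0 - delta) +
  (RInt pospart (x0 - delta) (x0 + delta) + RInt pospart (x0 + delta) PI)).
assert (0 <= RInt pospart (- PI) (x0 - delta)).
{ apply RInt_ge_0; [lra|now apply ex_RInt_cont|auto]. }
assert (0 <= RInt pospart (x0 + delta) PI).
{ apply RInt_ge_0; [lra|now apply ex_RInt_cont|auto]. }
assert (0 < RInt pospart (x0 - delta) (x0 + delta)).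
{ apply RInt_gt_0; [lra| |intros; apply P].
  intros x Hx; unfold pospart.
  assert (0 < u x); [|rewrite Rabs_right; lra].
  unfold u.
  replace (cos (x - x0)) with (cos (Rabs (x - x0))).
  2:{ unfold Rabs; destruct Rcase_abs; [now rewrite cos_neg|reflexivity]. }
  assert (Rabs (x - x0) < delta) by (apply Rabs_def1; lra).
  assert (cos delta < cos (Rabs (x - x0))); [|lra].
  apply cos_decreasing_1; try apply Rabs_pos; lra. }
lra.
Qed.

(* Orthogonality to the trigonometric polynomial [(1 + u)^n], which grows with
   [n] only where [f >= h]. *)
Lemma peak_absurd : False.
Proof.
pose proof peak_pospart_cont as P; pose proof peak_pospart_int as I.
assert (B0 : 0 <= B).
{ assert (H : - PI <= x0 <= PI) by lra.
  specialize (f_bound x0 H); pose proof (Rabs_pos (f x0)); lra. }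
(* The pairing of [f] with [(1 + u)^n] is zero, but it is at least [n h] times the integral of
   [pospart], minus [2 * PI * B]. *)
assert (L : forall n : nat, INR n * h * RInt pospart (- PI) PI <= 2 * PI * B).
{ intros n.
  pose proof (peak_orth n 0 0) as O.
  set (I' := RInt pospart (- PI) PI) in *.
  assert (C : RInt (fun x => INR n * h * pospart x + - B) (- PI) PI
    <= RInt (fun x => f x * (1 + u x) ^ n * cos (0 * x + 0)) (- PI) PI).
  { apply RInt_le.
    - pose proof PI_RGT_0; lra.
    - apply ex_RInt_cont, continuous_fun_plus; [|apply continuous_fun_const].
      apply continuous_fun_mult; [apply continuous_fun_const|assumption].
    - apply ex_RInt_cont, continuous_fun_mult; [|apply continuous_fun_affine_cos].
      apply continuous_fun_mult; [assumption|apply continuous_fun_pow].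
      apply continuous_fun_plus; [apply continuous_fun_const|apply peak_cont].
    - intros x Hx.
      replace (0 * x + 0) with 0 by ring; rewrite cos_0, Rmult_1_r.
      unfold pospart.
      (* On the peak, Bernoulli's inequality [poly] bounds [(1 + u)^n] below by [1 + n u]. Off the
         peak [|1 + u| <= 1], so the integrand is at least [- B]. *)
      destruct (Rlt_le_dec 0 (u x)) as [Hu|Hu].
      + rewrite (Rabs_right (u x)) by lra.
        assert (Hf : h <= f x) by (apply f_near, peak_near; lra).
        pose proof (poly n (u x) Hu) as Bern.
        assert (0 <= INR n * u x).
        { apply Rmult_le_pos; [apply pos_INR|lra]. }
        nra.
      + replace ((u x + Rabs (u x)) / 2) with 0 by (rewrite Rabs_left1; lra).
        assert (Hf : Rabs (f x) <= B) by (apply f_bound; lra).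
        assert (Ht : Rabs ((1 + u x) ^ n) <= 1).
        { rewrite <- RPow_abs; apply Rle_trans with (1 ^ n); [|rewrite pow1; lra].
          apply pow_incr; split; [apply Rabs_pos|].
          apply Rabs_le, peak_far, Hu. }
        assert (Rabs (f x * (1 + u x) ^ n) <= B * 1).
        { rewrite Rabs_mult; apply Rmult_le_compat; auto using Rabs_pos. }
        pose proof (Rabs_maj2 (f x * (1 + u x) ^ n)); lra. }
  rewrite O, RInt_cont_plus, RInt_cont_scal, RInt_const in C;
    auto using continuous_fun_const, continuous_fun_mult.
  change (scal ?a ?b) with (a * b) in C.
  fold I' in C; lra. }
set (I' := RInt pospart (- PI) PI) in *.
assert (K : 0 < h * I') by now apply Rmult_lt_0_compat.
destruct (INR_archimed (h * I') (2 * PI * B) K) as [n Hn].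
specialize (L n); lra.
Qed.

End peak.

(** Left unnormalised; this is where the factors [PI] in the coefficient formulas come from. *)
Definition cos_coeff (m : nat) (f : R -> R) : R :=
  RInt (fun x => f x * cos (INR m * x)) (- PI) PI.

(** By the addition formula, the phase only brings in sine coefficients, which vanish by parity. *)
Lemma even_orthogonal (f : R -> R) :
  continuous_fun f -> even_fun f -> (forall m, cos_coeff m f = 0) ->
  forall (m : Z) (theta : R),
  RInt (fun x => f x * cos (IZR m * x + theta)) (- PI) PI = 0.
Proof.
intros F E H m theta.
rewrite (RInt_fun_ext _ (fun x => cos theta * (f x * cos (INR (Z.abs_nat m) * x))
  + - sin theta * (f x * sin (IZR m * x)))).
- rewrite RInt_cont_plus, !RInt_cont_scal; try apply continuous_fun_mult;
    auto using continuous_fun_mult, continuous_fun_const,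
      continuous_fun_cos, continuous_fun_sin.
  specialize (H (Z.abs_nat m)); unfold cos_coeff in H; rewrite H.
  rewrite (RInt_odd (fun x => f x * sin (IZR m * x))); [apply Rminus_diag_uniq; ring| |].
  + auto using continuous_fun_mult, continuous_fun_sin.
  + intros x; rewrite E, Ropp_mult_distr_r_reverse, sin_neg; ring.
- intros x; rewrite cos_plus, INR_IZR_INZ, Zabs2Nat.id_abs, abs_IZR.
  replace (cos (Rabs (IZR m) * x)) with (cos (IZR m * x)); [ring|].
  unfold Rabs; destruct Rcase_abs; [|reflexivity].
  now rewrite <- cos_neg, Ropp_mult_distr_l.
Qed.

(** A positive value at [x0] would persist at half height on a neighbourhood, the situation refuted
    by [peak_absurd]. The bound is one-sided; the other side comes from [- f]. *)
Lemma cos_coeff_zero_le (f : R -> R) :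
  continuous_fun f -> even_fun f -> (forall m, cos_coeff m f = 0) ->
  forall x, - PI < x < PI -> f x <= 0.
Proof.
intros F E H x0 Hx0; apply Rnot_lt_le; intros P.
pose proof (proj1 (filterlim_locally f (f x0)) (F x0)) as C.
destruct (C (mkposreal (f x0 / 2) ltac:(lra))) as [d Hd].
destruct (continuity_ab_maj (fun x => Rabs (f x)) (- PI) PI) as [M [HM _]].
{ pose proof PI_RGT_0; lra. }
{ intros x _; apply continuity_pt_filterlim, continuous_Rabs_comp, F. }
(* The peak must also fit inside [[-PI, PI]]. *)
set (delta := Rmin d (Rmin (PI - x0) (PI + x0))).
assert (D : 0 < delta /\ delta <= d /\ delta <= PI - x0 /\ delta <= PI + x0).
{ unfold delta; pose proof (cond_pos d); unfold Rmin.
  repeat destruct Rle_dec; lra. }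
apply (peak_absurd f x0 delta (f x0 / 2) (Rabs (f M))); try lra; auto.
- intros x Hx.
  assert (A : Rabs (f x - f x0) < f x0 / 2).
  { apply (Hd x); change (Rabs (x - x0) < d); apply Rabs_def1; lra. }
  apply Rabs_def2 in A; lra.
- now apply even_orthogonal.
Qed.

Lemma cos_coeff_scal (m : nat) (c : R) (f : R -> R) :
  continuous_fun f -> cos_coeff m (fun x => c * f x) = c * cos_coeff m f.
Proof.
intros F; unfold cos_coeff; rewrite <- RInt_cont_scal.
- apply RInt_fun_ext; intros; ring.
- auto using continuous_fun_mult, continuous_fun_cos.
Qed.

Lemma cos_coeff_plus (m : nat) (f g : R -> R) :
  continuous_fun f -> continuous_fun g ->
  cos_coeff m (fun x => f x + g x) = cos_coeff m f + cos_coeff m g.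
Proof.
intros F G; unfold cos_coeff; rewrite <- RInt_cont_plus;
  auto using continuous_fun_mult, continuous_fun_cos.
apply RInt_fun_ext; intros; ring.
Qed.

Lemma cos_coeff_ext (m : nat) (f g : R -> R) :
  (forall x, f x = g x) -> cos_coeff m f = cos_coeff m g.
Proof. intros E; apply RInt_fun_ext; intros; now rewrite E. Qed.

Lemma cos_coeff_minus (m : nat) (f g : R -> R) :
  continuous_fun f -> continuous_fun g ->
  cos_coeff m (fun x => f x - g x) = cos_coeff m f - cos_coeff m g.
Proof.
intros F G.
rewrite (cos_coeff_ext m _ (fun x => f x + (-1) * g x)) by (intros; ring).
rewrite cos_coeff_plus, cos_coeff_scal; auto using continuous_fun_mult, continuous_fun_const.
ring.
Qed.

Lemma cos_coeff_sum (m : nat) (u : nat -> R -> R) (n : nat) :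
  (forall j, continuous_fun (u j)) ->
  cos_coeff m (fun x => sum_n (fun j => u j x) n) = sum_n (fun j => cos_coeff m (u j)) n.
Proof.
intros H; induction n as [|n IH].
- rewrite sum_O; apply cos_coeff_ext; intros; now rewrite sum_O.
- rewrite sum_n_S, <- IH, <- cos_coeff_plus; auto using continuous_fun_sum.
  apply cos_coeff_ext; intros; now rewrite sum_n_S.
Qed.

Lemma cos_coeff_bound (m : nat) (f : R -> R) (M : R) :
  continuous_fun f -> (forall x, Rabs (f x) <= M) ->
  Rabs (cos_coeff m f) <= 2 * PI * M.
Proof.
intros F H; pose proof PI_RGT_0.
replace (2 * PI * M) with ((PI - - PI) * M) by ring.
apply abs_RInt_le_const; [lra| |].
- apply ex_RInt_cont; auto using continuous_fun_mult, continuous_fun_cos.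
- intros x _; rewrite Rabs_mult, <- (Rmult_1_r M).
  apply Rmult_le_compat; auto using Rabs_pos.
  apply Rabs_le, COS_bound.
Qed.

Lemma periodic_nat (L : R) (f : R -> R) (n : nat) :
  periodic L f -> forall x, f (x + INR n * L) = f x.
Proof.
intros P; induction n as [|n IH]; intros x.
- simpl; f_equal; ring.
- rewrite S_INR, <- (IH x), <- (P (x + INR n * L)); f_equal; ring.
Qed.

Lemma cos_coeff_unique (f : R -> R) :
  continuous_fun f -> even_fun f -> periodic (2 * PI) f ->
  (forall m, cos_coeff m f = 0) -> forall x, f x = 0.
Proof.
intros F E P H.
pose proof PI_RGT_0 as Pi.
assert (I : forall x, - PI < x < PI -> f x = 0).
{ intros x Hx; apply Rle_antisym; [now apply cos_coeff_zero_le|].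
  apply Ropp_le_cancel; rewrite Ropp_0.
  replace (- f x) with (-1 * f x) by ring.
  apply (cos_coeff_zero_le (fun x => -1 * f x)); auto.
  - auto using continuous_fun_mult, continuous_fun_const.
  - intros y; now rewrite E.
  - intros m; rewrite cos_coeff_scal, H by assumption; ring. }
(* The peak argument reaches only the open interval; the end point follows by continuity. *)
assert (J : f PI = 0).
{ apply NNPP; intros N.
  pose proof (proj1 (filterlim_locally f (f PI)) (F PI)) as C.
  destruct (C (mkposreal _ (Rabs_pos_lt _ N))) as [d Hd].
  set (y := PI - Rmin (d / 2) PI).
  assert (Y : 0 < Rmin (d / 2) PI <= d / 2 /\ Rmin (d / 2) PI <= PI).
  { pose proof (cond_pos d); unfold Rmin; destruct Rle_dec; lra. }
  assert (A : Rabs (f y - f PI) < Rabs (f PI)).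
  { apply (Hd y); change (Rabs (y - PI) < d); apply Rabs_def1; unfold y; lra. }
  rewrite (I y) in A by (unfold y; lra).
  replace (0 - f PI) with (- f PI) in A by ring.
  rewrite Rabs_Ropp in A; lra. }
assert (K : forall n x, - PI <= x <= PI -> f (x + INR n * (2 * PI)) = 0).
{ intros n x Hx; rewrite periodic_nat by assumption.
  destruct (Req_dec x PI) as [->|N1]; [assumption|].
  destruct (Req_dec x (- PI)) as [->|N2]; [now rewrite E|].
  apply I; lra. }
assert (K' : forall x, 0 <= x -> f x = 0).
{ intros x Hx.
  (* Subtracting this number of periods brings [x] into [[-PI, PI]]. *)
  destruct (nfloor_ex ((x + PI) / (2 * PI))) as [n [N1 N2]].
  { apply Rdiv_le_0_compat; lra. }
  apply (Rmult_le_compat_r (2 * PI)) in N1; [|lra].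
  apply (Rmult_lt_compat_r (2 * PI)) in N2; [|lra].
  replace ((x + PI) / (2 * PI) * (2 * PI)) with (x + PI) in N1, N2 by (field; lra).
  replace x with (x - INR n * (2 * PI) + INR n * (2 * PI)) by ring.
  apply K; lra. }
intros x; destruct (Rle_dec 0 x); [auto|].
rewrite <- E; apply K'; lra.
Qed.

(** * Orthogonality of the cosines *)

Definition full_period (n : Z) : R := if Z.eq_dec n 0 then 2 * PI else 0.

Lemma RInt_cos_Z (n : Z) :
  RInt (fun x => cos (IZR n * x)) (- PI) PI = full_period n.
Proof.
unfold full_period; destruct Z.eq_dec as [->|N].
- rewrite (RInt_fun_ext _ (fun _ => 1)).
  + rewrite RInt_const; change (scal ?a ?b) with (a * b);
    apply Rminus_diag_uniq; ring.
  + intros; now rewrite Rmult_0_l, cos_0.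
- apply eq_IZR_contrapositive in N.
  apply is_RInt_unique.
  replace 0 with (minus (sin (IZR n * PI) / IZR n) (sin (IZR n * - PI) / IZR n)).
  + apply (is_RInt_derive (fun x => sin (IZR n * x) / IZR n)); intros x _.
    * auto_derive; [easy|field; assumption].
    * apply continuous_fun_cos.
  + change (minus ?a ?b) with (a - b).
    rewrite !sin_eq_0_1; [apply Rminus_diag_uniq; unfold Rdiv; ring| |].
    * exists (- n)%Z; rewrite opp_IZR; ring.
    * now exists n.
Qed.

Lemma RInt_cos_cos (a b : Z) :
  RInt (fun x => cos (IZR a * x) * cos (IZR b * x)) (- PI) PI =
  (full_period (a + b) + full_period (a - b)) / 2.
Proof.
rewrite (RInt_fun_ext _ (fun x => 1 / 2 * cos (IZR (a + b) * x)
  + 1 / 2 * cos (IZR (a - b) * x))).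
- rewrite RInt_cont_plus, !RInt_cont_scal, !RInt_cos_Z;
    auto using continuous_fun_mult, continuous_fun_const, continuous_fun_cos.
  apply Rminus_diag_uniq; field.
- intros x; rewrite plus_IZR, minus_IZR, Rmult_plus_distr_r, Rmult_minus_distr_r.
  rewrite cos_plus, cos_minus; field.
Qed.

(** [1 <= n] excludes the constant function, whose coefficient at [m = 0] is [2 * PI] instead of
    [PI]. *)
Lemma cos_coeff_cos (m n : nat) : (1 <= n)%nat ->
  cos_coeff m (fun x => cos (INR n * x)) = if Nat.eq_dec m n then PI else 0.
Proof.
intros Hn; unfold cos_coeff.
rewrite !INR_IZR_INZ, RInt_cos_cos; unfold full_period.
repeat destruct Z.eq_dec; destruct Nat.eq_dec; try lia; lra.
Qed.

(** * The coefficients of [cos^p] and of [Phi] *)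

Lemma C_n_0 (n : nat) : Binomial.C n 0 = 1.
Proof.
unfold Binomial.C; rewrite Nat.sub_0_r; simpl; field; apply INR_fact_neq_0.
Qed.

Lemma C_n_n (n : nat) : Binomial.C n n = 1.
Proof.
unfold Binomial.C; rewrite Nat.sub_diag; simpl; field; apply INR_fact_neq_0.
Qed.

(** The frequency is an integer so that the recursion on [p], which steps from [m] to [m + k] and
    [m - k], stays in the domain. *)
Definition cos_pow_coeff (k p : nat) (m : Z) : R :=
  RInt (fun x => cos (INR k * x) ^ p * cos (IZR m * x)) (- PI) PI.

Lemma cos_pow_coeff_0 (k : nat) (m : Z) : cos_pow_coeff k 0 m = full_period m.
Proof.
unfold cos_pow_coeff; rewrite <- RInt_cos_Z; apply RInt_fun_ext; intros; simpl; ring.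
Qed.

Lemma cos_pow_coeff_S (k p : nat) (m : Z) :
  cos_pow_coeff k (S p) m =
  (cos_pow_coeff k p (m + Z.of_nat k) + cos_pow_coeff k p (m - Z.of_nat k)) / 2.
Proof.
unfold cos_pow_coeff.
assert (Q : forall q : Z, continuous_fun (fun x => cos (INR k * x) ^ p * cos (IZR q * x))).
{ intros q; apply continuous_fun_mult; [|apply continuous_fun_cos].
  apply continuous_fun_pow, continuous_fun_cos. }
rewrite (RInt_fun_ext _ (fun x =>
  1 / 2 * (cos (INR k * x) ^ p * cos (IZR (m + Z.of_nat k) * x)) +
  1 / 2 * (cos (INR k * x) ^ p * cos (IZR (m - Z.of_nat k) * x)))).
- rewrite RInt_cont_plus, !RInt_cont_scal; auto using continuous_fun_mult, continuous_fun_const.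
  apply Rminus_diag_uniq; field.
- intros x.
  rewrite plus_IZR, minus_IZR, <- INR_IZR_INZ, Rmult_plus_distr_r, Rmult_minus_distr_r.
  rewrite cos_plus, cos_minus; simpl; field.
Qed.

(* [cos^p(kx)] spreads [2 pi] over the end points of [p] steps [+-k] from 0. *)
Lemma cos_pow_coeff_eq (k p : nat) : (1 <= k)%nat ->
  (forall i, (i <= p)%nat ->
    cos_pow_coeff k p ((Z.of_nat p - 2 * Z.of_nat i) * Z.of_nat k)
      = 2 * PI * Binomial.C p i / 2 ^ p) /\
  (forall m : Z, (forall i, (i <= p)%nat ->
      m <> ((Z.of_nat p - 2 * Z.of_nat i) * Z.of_nat k)%Z) ->
    cos_pow_coeff k p m = 0).
Proof.
intros Hk; induction p as [|p [IA IB]].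
- split.
  + intros i Hi; replace i with 0%nat by lia.
    rewrite cos_pow_coeff_0, C_n_0; unfold full_period.
    destruct Z.eq_dec; [simpl; field|lia].
  + intros m Hm; rewrite cos_pow_coeff_0; unfold full_period.
    destruct Z.eq_dec; [|reflexivity].
    exfalso; apply (Hm 0%nat); lia.
- split.
  + intros i Hi; rewrite cos_pow_coeff_S.
    assert (P2 : 2 ^ p <> 0) by (apply pow_nonzero; lra).
    (* For [i = 0] and for [i = S p] one of the two neighbours is out of reach of [p] steps and
       contributes 0; otherwise the two add up by Pascal's rule. *)
    assert (L : cos_pow_coeff k p ((Z.of_nat (S p) - 2 * Z.of_nat i) * Z.of_nat k + Z.of_nat k)
      = match i with 0%nat => 0 | S i' => 2 * PI * Binomial.C p i' / 2 ^ p end).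
    { destruct i as [|i'].
      - apply IB; intros i' Hi'; nia.
      - rewrite <- IA by lia; f_equal; nia. }
    assert (R : cos_pow_coeff k p ((Z.of_nat (S p) - 2 * Z.of_nat i) * Z.of_nat k - Z.of_nat k)
      = if Nat.eq_dec i (S p) then 0 else 2 * PI * Binomial.C p i / 2 ^ p).
    { destruct Nat.eq_dec.
      - apply IB; intros i' Hi'; nia.
      - rewrite <- IA by lia; f_equal; nia. }
    rewrite L, R; clear L R.
    simpl (2 ^ S p).
    destruct i as [|i']; destruct Nat.eq_dec as [E|E]; try lia.
    * rewrite !C_n_0; field; assumption.
    * injection E as ->; rewrite !C_n_n; field; assumption.
    * rewrite <- pascal by lia; field; assumption.
  + intros m Hm; rewrite cos_pow_coeff_S, !IB; [field| |].
    * intros i Hi E; apply (Hm i); [lia|nia].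
    * intros i Hi E; apply (Hm (S i)); [lia|nia].
Qed.

Lemma cos_coeff_pow (k p m : nat) :
  cos_coeff m (fun x => cos (INR k * x) ^ p) = cos_pow_coeff k p (Z.of_nat m).
Proof.
unfold cos_coeff, cos_pow_coeff; now rewrite <- INR_IZR_INZ.
Qed.

Lemma cos_coeff_pow_hit (k p j : nat) : (1 <= k)%nat -> (2 * j < p)%nat ->
  cos_coeff ((p - 2 * j) * k) (fun x => cos (INR k * x) ^ p) =
  PI * (Binomial.C p j / 2 ^ (p - 1)).
Proof.
intros Hk Hj; rewrite cos_coeff_pow.
replace (Z.of_nat ((p - 2 * j) * k)) with ((Z.of_nat p - 2 * Z.of_nat j) * Z.of_nat k)%Z by nia.
rewrite (proj1 (cos_pow_coeff_eq k p Hk)) by lia.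
destruct p as [|p]; [lia|].
replace (S p - 1)%nat with p by lia; simpl (2 ^ S p).
field; apply pow_nonzero; lra.
Qed.

Lemma cos_coeff_pow_miss (k p m : nat) : (1 <= k)%nat -> (1 <= m)%nat ->
  (forall j, (2 * j < p)%nat -> m <> ((p - 2 * j) * k)%nat) ->
  cos_coeff m (fun x => cos (INR k * x) ^ p) = 0.
Proof.
intros Hk Hm H; rewrite cos_coeff_pow.
apply (proj2 (cos_pow_coeff_eq k p Hk)).
intros i Hi E.
assert (2 * i < p)%nat by nia.
apply (H i); nia.
Qed.

Lemma sum_n_zero (u : nat -> R) (n : nat) :
  (forall j, (j <= n)%nat -> u j = 0) -> sum_n u n = 0.
Proof.
intros H; rewrite (sum_n_ext_loc _ (fun _ => 0)) by assumption.
exact (eq_trans (sum_n_const n 0) (Rmult_0_r _)).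
Qed.

Lemma sum_n_single (u : nat -> R) (i n : nat) : (i <= n)%nat ->
  (forall j, (j <= n)%nat -> j <> i -> u j = 0) -> sum_n u n = u i.
Proof.
intros Hi H; induction n as [|n IH].
- rewrite sum_O; f_equal; lia.
- rewrite sum_n_S; destruct (Nat.eq_dec i (S n)) as [->|N].
  + rewrite sum_n_zero; [apply Rplus_0_l|].
    intros j Hj; apply H; lia.
  + rewrite IH, (H (S n)); [apply Rplus_0_r| | | |]; try lia.
    intros j Hj; apply H; lia.
Qed.

Lemma pow_pred (x : R) (n : nat) : (1 <= n)%nat -> x ^ n = x * x ^ (n - 1).
Proof. intros Hn; destruct n; [lia|]; simpl; now rewrite Nat.sub_0_r. Qed.

(** * The correction [Phi] and the origin of its coefficients *)

Definition Phi_last (p : nat) : nat :=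
  if Nat.even p then (p / 2 - 1)%nat else ((p - 3) / 2)%nat.

Lemma Phi_sum (alpha : R) (p k : nat) (x : R) :
  Phi alpha p k x = sum_n (fun j => coef_Phi alpha p k j x) (Phi_last p).
Proof. unfold Phi, Phi_last; now destruct (Nat.even p). Qed.

(** In both parities the sum keeps the harmonics with [p - 2 * j >= 2]; the mean and the resonant
    mode [k] are left out. *)
Lemma Phi_last_spec (p j : nat) : (2 <= p)%nat ->
  (j <= Phi_last p)%nat <-> (2 * j + 1 < p)%nat \/ (p = 3 /\ j = 0)%nat.
Proof.
intros Hp; unfold Phi_last.
destruct (Nat.even p) eqn:E.
- apply Nat.even_spec in E; destruct E as [q ->].
  rewrite (Nat.mul_comm 2 q), Nat.div_mul by lia; lia.
- assert (O : Nat.odd p = true) by (unfold Nat.odd; now rewrite E).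
  apply Nat.odd_spec in O; destruct O as [q ->].
  replace (2 * q + 1 - 3)%nat with ((q - 1) * 2)%nat by lia.
  rewrite Nat.div_mul by lia; lia.
Qed.

Lemma coef_Phi_continuous (alpha : R) (p k j : nat) :
  continuous_fun (coef_Phi alpha p k j).
Proof.
apply continuous_fun_mult; [apply continuous_fun_const|apply continuous_fun_cos].
Qed.

Lemma Phi_continuous (alpha : R) (p k : nat) : continuous_fun (Phi alpha p k).
Proof.
apply continuous_fun_ext with (1 := fun x => eq_sym (Phi_sum alpha p k x)).
apply continuous_fun_sum; intros; apply coef_Phi_continuous.
Qed.

Lemma cos_INR_even (n : nat) : even_fun (fun x => cos (INR n * x)).
Proof. intros x; rewrite Ropp_mult_distr_r_reverse; apply cos_neg. Qed.

Lemma cos_INR_periodic (n : nat) : periodic (2 * PI) (fun x => cos (INR n * x)).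
Proof.
intros x; rewrite Rmult_plus_distr_l.
replace (INR n * (2 * PI)) with (2 * INR n * PI) by ring; apply cos_period.
Qed.

Lemma Phi_even_fun (alpha : R) (p k : nat) : even_fun (Phi alpha p k).
Proof.
intros x; rewrite !Phi_sum; apply sum_n_ext; intros j; unfold coef_Phi.
now rewrite (cos_INR_even _ x).
Qed.

Lemma Phi_periodic (alpha : R) (p k : nat) : periodic (2 * PI) (Phi alpha p k).
Proof.
intros x; rewrite !Phi_sum; apply sum_n_ext; intros j; unfold coef_Phi.
now rewrite (cos_INR_periodic _ x).
Qed.

Lemma cos_coeff_Phi (alpha : R) (p k m : nat) : (2 <= p)%nat -> (1 <= k)%nat ->
  cos_coeff m (Phi alpha p k) =
  sum_n (fun j => coef_C alpha p k j *
    if Nat.eq_dec m ((p - 2 * j) * k) then PI else 0) (Phi_last p).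
Proof.
intros Hp Hk.
rewrite (cos_coeff_ext _ _ _ (Phi_sum alpha p k)).
rewrite cos_coeff_sum by (intros; apply coef_Phi_continuous).
apply sum_n_ext_loc; intros j Hj.
apply Phi_last_spec in Hj; [|assumption].
unfold coef_Phi; rewrite cos_coeff_scal by apply continuous_fun_cos.
rewrite cos_coeff_cos; [reflexivity|nia].
Qed.

Lemma cos_coeff_Phi_hit (alpha : R) (p k j : nat) :
  (2 <= p)%nat -> (1 <= k)%nat -> (j <= Phi_last p)%nat ->
  cos_coeff ((p - 2 * j) * k) (Phi alpha p k) = PI * coef_C alpha p k j.
Proof.
intros Hp Hk Hj; rewrite cos_coeff_Phi by assumption.
rewrite (sum_n_single _ j _ Hj).
- destruct Nat.eq_dec; [ring|lia].
- intros i Hi N; destruct Nat.eq_dec as [E|]; [|ring].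
  apply Phi_last_spec in Hi, Hj; try assumption; nia.
Qed.

Lemma cos_coeff_Phi_miss (alpha : R) (p k m : nat) :
  (2 <= p)%nat -> (1 <= k)%nat ->
  (forall j, (j <= Phi_last p)%nat -> m <> ((p - 2 * j) * k)%nat) ->
  cos_coeff m (Phi alpha p k) = 0.
Proof.
intros Hp Hk H; rewrite cos_coeff_Phi by assumption.
apply sum_n_zero; intros j Hj; destruct Nat.eq_dec as [E|]; [|ring].
now apply H in E.
Qed.

Lemma cos_coeff_Phi_0 (alpha : R) (p k : nat) :
  (2 <= p)%nat -> (1 <= k)%nat -> cos_coeff 0 (Phi alpha p k) = 0.
Proof.
intros Hp Hk; apply cos_coeff_Phi_miss; try assumption.
intros j Hj; apply Phi_last_spec in Hj; [nia|assumption].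
Qed.

Lemma cos_coeff_Phi_k (alpha : R) (p k : nat) :
  (2 <= p)%nat -> (1 <= k)%nat -> cos_coeff k (Phi alpha p k) = 0.
Proof.
intros Hp Hk; apply cos_coeff_Phi_miss; try assumption.
intros j Hj; apply Phi_last_spec in Hj; [nia|assumption].
Qed.

(** Nonresonance: [t^-alpha] is injective on positive [t], so at speed [k^-alpha] only the mode [k]
    is in the kernel of the linearisation. *)
Lemma Rpower_INR_neq (alpha : R) (k m : nat) : alpha <> 0 ->
  (1 <= k)%nat -> (1 <= m)%nat -> m <> k ->
  Rpower (INR k) (- alpha) - Rpower (INR m) (- alpha) <> 0.
Proof.
intros Ha Hk Hm N E; apply N.
apply Rminus_diag_uniq, exp_inv in E.
apply Rmult_eq_reg_l in E; [|lra].
apply ln_inv in E; try (apply lt_0_INR; lia).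
now apply INR_eq.
Qed.

(** This is the equation that [coef_C] is designed to solve:
    [(k^-alpha - |D|^-alpha) Phi = cos^p(kx)] away from the modes 0 and [k]. *)
Lemma cos_coeff_Phi_eq (alpha : R) (p k m : nat) : alpha <> 0 ->
  (2 <= p)%nat -> (1 <= k)%nat -> (1 <= m)%nat -> m <> k ->
  (Rpower (INR k) (- alpha) - Rpower (INR m) (- alpha)) * cos_coeff m (Phi alpha p k) =
  cos_coeff m (fun x => cos (INR k * x) ^ p).
Proof.
intros Ha Hp Hk Hm N.
destruct (classic (exists j, 2 * j < p /\ m = (p - 2 * j) * k)%nat) as [[j [Hj E]]|H].
(* [m <> k] rules out [p - 2 * j = 1], the only positive harmonic that [Phi] omits. *)
- assert (J : (j <= Phi_last p)%nat) by (apply Phi_last_spec; nia).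
  pose proof (Rpower_INR_neq alpha k m Ha Hk Hm N) as D.
  subst m; rewrite cos_coeff_Phi_hit, cos_coeff_pow_hit by assumption.
  unfold coef_C; field.
  split; [apply pow_nonzero; lra|assumption].
- rewrite cos_coeff_pow_miss, cos_coeff_Phi_miss; try assumption; [ring| |].
  + intros j Hj E; apply H; exists j; split; [|assumption].
    apply Phi_last_spec in Hj; lia.
  + intros j Hj E; apply H; now exists j.
Qed.

(** An even power contains only even multiples of the frequency [k]. *)
Lemma cos_coeff_pow_even (k p : nat) : (1 <= k)%nat -> Nat.Even p ->
  cos_coeff k (fun x => cos (INR k * x) ^ p) = 0.
Proof.
intros Hk [q ->]; apply cos_coeff_pow_miss; try assumption.
intros j Hj E; nia.
Qed.

Lemma cos_coeff_pow_odd (k p : nat) : (1 <= k)%nat -> Nat.Odd p ->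
  cos_coeff k (fun x => cos (INR k * x) ^ p) = PI * C_odd p.
Proof.
intros Hk [q ->].
pose proof (cos_coeff_pow_hit k (2 * q + 1) q Hk ltac:(lia)) as H.
replace ((2 * q + 1 - 2 * q) * k)%nat with k in H by nia.
rewrite H; unfold C_odd, Rdiv.
replace ((2 * q + 1 - 1) / 2)%nat with q; [ring|].
replace (2 * q + 1 - 1)%nat with (q * 2)%nat by lia.
now rewrite Nat.div_mul.
Qed.

(** The origin of [C_even]: the resonant part of the linear term [p cos^(p-1)(kx) Phi] in the
    expansion of the power. Pascal's rule turns [Binomial.C p j] into the sum of two binomials in
    its definition. *)
Lemma cos_coeff_pow_Phi (alpha : R) (p k : nat) :
  (2 <= p)%nat -> (1 <= k)%nat -> Nat.Even p ->
  INR p * cos_coeff k (fun x => cos (INR k * x) ^ (p - 1) * Phi alpha p k x) =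
  PI * C_even alpha p k.
Proof.
intros Hp Hk Ev.
assert (CP : forall n, continuous_fun (fun x => cos (INR k * x) ^ n)).
{ intros; apply continuous_fun_pow, continuous_fun_cos. }
assert (E : cos_coeff k (fun x => cos (INR k * x) ^ (p - 1) * Phi alpha p k x) =
  PI / 2 ^ (p - 1) * sum_n (fun j => Binomial.C p j * coef_C alpha p k j) (Phi_last p)).
{ rewrite (cos_coeff_ext _ _ (fun x => sum_n (fun j =>
    cos (INR k * x) ^ (p - 1) * coef_Phi alpha p k j x) (Phi_last p))).
  2:{ intros x; rewrite Phi_sum; symmetry; apply (sum_n_mult_l (cos (INR k * x) ^ (p - 1))). }
  rewrite cos_coeff_sum.
  2:{ intros j; apply continuous_fun_mult; [apply CP|apply coef_Phi_continuous]. }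
  rewrite <- (sum_n_mult_l (K := R_Ring) (PI / 2 ^ (p - 1))).
  apply sum_n_ext_loc; intros j Hj; change (mult ?a ?b) with (a * b).
  apply Phi_last_spec in Hj; [|assumption].
  (* The test function [cos (k x)] is absorbed into the power, which leaves a known coefficient of
     [cos^p]. *)
  transitivity (coef_C alpha p k j *
    cos_coeff ((p - 2 * j) * k) (fun x => cos (INR k * x) ^ p)).
  - rewrite <- cos_coeff_scal by apply CP.
    apply RInt_fun_ext; intros x; unfold coef_Phi.
    rewrite (pow_pred (cos (INR k * x)) p) by lia; ring.
  - rewrite cos_coeff_pow_hit by lia; apply Rminus_diag_uniq; field; apply pow_nonzero; lra. }
rewrite E; unfold C_even, sum_n, Phi_last.
rewrite (proj2 (Nat.even_spec p) Ev).
rewrite sum_Sn_m by lia; change (plus ?a ?b) with (a + b).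
rewrite C_n_0.
rewrite (sum_n_m_ext_loc (fun j => Binomial.C p j * coef_C alpha p k j)
  (fun j => (Binomial.C (p - 1) j + Binomial.C (p - 1) (j - 1)) * coef_C alpha p k j)).
- field; apply pow_nonzero; lra.
- intros j Hj.
  assert (j < p - 1)%nat.
  { destruct Ev as [q ->]; rewrite (Nat.mul_comm 2 q), Nat.div_mul in Hj; lia. }
  pose proof (pascal (p - 1) (j - 1) ltac:(lia)) as P.
  replace (S (j - 1)) with j in P by lia; replace (S (p - 1)) with p in P by lia.
  rewrite <- P; apply Rminus_diag_uniq; ring.
Qed.

(** * Asymptotics as [s] tends to 0, uniformly in [x] *)

(** The neighbourhood contains [s = 0], so for [n >= 1] the bound also forces [F 0 x = 0]. *)
Definition unif_O (F : R -> R -> R) (n : nat) : Prop :=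
  exists M, locally 0 (fun s => forall x, Rabs (F s x) <= M * Rabs s ^ n).

Definition bigO (f : R -> R) (n : nat) : Prop := unif_O (fun s _ => f s) n.

Lemma unif_O_pos (F : R -> R -> R) (n : nat) : unif_O F n ->
  exists M, 0 <= M /\ locally 0 (fun s => forall x, Rabs (F s x) <= M * Rabs s ^ n).
Proof.
intros [M H]; exists (Rabs M); split; [apply Rabs_pos|].
revert H; apply filter_imp; intros s H x.
eapply Rle_trans; [apply H|].
apply Rmult_le_compat_r; [apply pow_le, Rabs_pos|apply Rle_abs].
Qed.

Lemma locally_0_lt (r : R) : 0 < r -> locally 0 (fun s => Rabs s < r).
Proof.
intros Hr; exists (mkposreal r Hr); intros s Hs.
change (Rabs (s - 0) < r) in Hs; now rewrite Rminus_0_r in Hs.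
Qed.

Lemma unif_O_ext_loc (F G : R -> R -> R) (n : nat) :
  locally 0 (fun s => forall x, F s x = G s x) -> unif_O F n -> unif_O G n.
Proof.
intros E [M H]; exists M.
generalize (filter_and _ _ E H); apply filter_imp.
intros s [E' H'] x; now rewrite <- E'.
Qed.

Lemma unif_O_ext (F G : R -> R -> R) (n : nat) :
  (forall s x, F s x = G s x) -> unif_O F n -> unif_O G n.
Proof. intros E; apply unif_O_ext_loc, filter_forall, E. Qed.

Lemma unif_O_weaken (F : R -> R -> R) (m n : nat) :
  (m <= n)%nat -> unif_O F n -> unif_O F m.
Proof.
intros L H; destruct (unif_O_pos _ _ H) as [M [M0 HM]]; exists M.
generalize (filter_and _ _ HM (locally_0_lt 1 Rlt_0_1)); apply filter_imp.
intros s [A B] x; eapply Rle_trans; [apply A|].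
apply Rmult_le_compat_l; [assumption|].
replace n with (m + (n - m))%nat by lia; rewrite pow_add.
rewrite <- (Rmult_1_r (Rabs s ^ m)) at 2.
apply Rmult_le_compat_l; [apply pow_le, Rabs_pos|].
rewrite <- (pow1 (n - m)); apply pow_incr; split; [apply Rabs_pos|lra].
Qed.

Lemma unif_O_plus (F G : R -> R -> R) (n : nat) :
  unif_O F n -> unif_O G n -> unif_O (fun s x => F s x + G s x) n.
Proof.
intros [M HM] [N HN]; exists (M + N).
generalize (filter_and _ _ HM HN); apply filter_imp.
intros s [A B] x; eapply Rle_trans; [apply Rabs_triang|].
specialize (A x); specialize (B x); lra.
Qed.

Lemma unif_O_mult (F G : R -> R -> R) (m n : nat) :
  unif_O F m -> unif_O G n -> unif_O (fun s x => F s x * G s x) (m + n).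
Proof.
intros [M HM] [N HN]; exists (M * N).
generalize (filter_and _ _ HM HN); apply filter_imp.
intros s [A B] x; rewrite Rabs_mult, pow_add.
replace (M * N * (Rabs s ^ m * Rabs s ^ n))
  with ((M * Rabs s ^ m) * (N * Rabs s ^ n)) by ring.
apply Rmult_le_compat; auto using Rabs_pos.
Qed.

Lemma unif_O_monomial (g : R -> R) (n : nat) :
  (exists M, forall x, Rabs (g x) <= M) -> unif_O (fun s x => s ^ n * g x) n.
Proof.
intros [M HM]; exists M; apply filter_forall; intros s x.
rewrite Rabs_mult, RPow_abs, Rmult_comm.
apply Rmult_le_compat_r; [apply Rabs_pos|apply HM].
Qed.

Lemma unif_O_const (c : R) : unif_O (fun _ _ => c) 0.
Proof.
exists (Rabs c); apply filter_forall; intros; simpl; lra.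
Qed.

Lemma unif_O_scal (c : R) (F : R -> R -> R) (n : nat) :
  unif_O F n -> unif_O (fun s x => c * F s x) n.
Proof. apply (unif_O_mult _ _ 0 n (unif_O_const c)). Qed.

Lemma unif_O_minus (F G : R -> R -> R) (n : nat) :
  unif_O F n -> unif_O G n -> unif_O (fun s x => F s x - G s x) n.
Proof.
intros HF HG; apply unif_O_ext with (2 := unif_O_plus _ _ _ HF (unif_O_scal (-1) _ _ HG)).
intros; ring.
Qed.

Lemma unif_O_pow (F : R -> R -> R) (n : nat) :
  unif_O F 1 -> unif_O (fun s x => F s x ^ n) n.
Proof.
intros H; induction n as [|n IH].
- exact (unif_O_const 1).
- exact (unif_O_mult _ _ _ _ H IH).
Qed.

(** Every telescoped term has one factor [X - Y] and [n] factors of order 1. *)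
Lemma unif_O_pow_diff (X Y : R -> R -> R) (n q : nat) :
  unif_O X 1 -> unif_O Y 1 -> unif_O (fun s x => X s x - Y s x) q ->
  unif_O (fun s x => X s x ^ S n - Y s x ^ S n) (n + q).
Proof.
intros HX HY HD; induction n as [|n IH].
- revert HD; apply unif_O_ext; intros; simpl; ring.
- apply unif_O_ext with (fun s x => X s x * (X s x ^ S n - Y s x ^ S n)
    + Y s x ^ S n * (X s x - Y s x)).
  { intros; simpl; ring. }
  apply unif_O_plus.
  + exact (unif_O_mult _ _ _ _ HX IH).
  + exact (unif_O_mult _ _ _ _ (unif_O_pow _ (S n) HY) HD).
Qed.

(** Taylor's formula for the power: the remainder is [(X - Y)^2] times a form of degree [n] in [X]
    and [Y]. *)
Lemma unif_O_pow_diff2 (X Y : R -> R -> R) (n q : nat) :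
  unif_O X 1 -> unif_O Y 1 -> unif_O (fun s x => X s x - Y s x) q ->
  unif_O (fun s x => X s x ^ S (S n) - Y s x ^ S (S n)
    - INR (S (S n)) * Y s x ^ S n * (X s x - Y s x)) (n + 2 * q).
Proof.
intros HX HY HD.
assert (HD2 : unif_O (fun s x => (X s x - Y s x) * (X s x - Y s x)) (2 * q)).
{ replace (2 * q)%nat with (q + q)%nat by lia; now apply unif_O_mult. }
induction n as [|n IH].
- revert HD2; apply unif_O_ext; intros; simpl; ring.
- apply unif_O_ext with (fun s x => X s x * (X s x ^ S (S n) - Y s x ^ S (S n)
      - INR (S (S n)) * Y s x ^ S n * (X s x - Y s x))
    + INR (S (S n)) * (Y s x ^ S n * ((X s x - Y s x) * (X s x - Y s x)))).
  { intros; rewrite (S_INR (S (S n))); simpl (_ ^ _); ring. }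
  apply unif_O_plus.
  + exact (unif_O_mult _ _ _ _ HX IH).
  + exact (unif_O_scal _ _ _ (unif_O_mult _ _ _ _ (unif_O_pow _ (S n) HY) HD2)).
Qed.

Lemma bigO_cos_coeff (F : R -> R -> R) (m n : nat) :
  locally 0 (fun s => continuous_fun (F s)) -> unif_O F n ->
  bigO (fun s => cos_coeff m (F s)) n.
Proof.
intros C [M H]; exists (2 * PI * M).
generalize (filter_and _ _ C H); apply filter_imp.
intros s [C' H'] _; rewrite Rmult_assoc; now apply cos_coeff_bound.
Qed.

(** The product says nothing about [f 0], hence the separate hypothesis. *)
Lemma bigO_div_s (f : R -> R) (n : nat) :
  f 0 = 0 -> bigO (fun s => s * f s) (S n) -> bigO f n.
Proof.
intros H0 H; destruct (unif_O_pos _ _ H) as [M [M0 HM]]; exists M.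
revert HM; apply filter_imp; intros s Hs x; specialize (Hs x); simpl in Hs.
assert (P : 0 <= Rabs s ^ n) by apply pow_le, Rabs_pos.
destruct (Req_dec s 0) as [->|N].
- rewrite H0, Rabs_R0; rewrite Rabs_R0 in P; nra.
- rewrite Rabs_mult in Hs; apply Rabs_pos_lt in N.
  apply Rmult_le_reg_l with (Rabs s); [assumption|]; lra.
Qed.

Lemma bigO_div_near (f g : R -> R) (l : R) (n : nat) :
  l <> 0 -> bigO (fun s => g s - l) 1 -> bigO (fun s => g s * f s) n -> bigO f n.
Proof.
intros Hl Hg H; destruct (unif_O_pos _ _ Hg) as [N [N0 HN]].
destruct (unif_O_pos _ _ H) as [M [M0 HM]].
apply Rabs_pos_lt in Hl.
exists (M * (2 / Rabs l)).
(* Within this radius [|g - l| <= |l| / 2], hence [|g| >= |l| / 2]; [N + 1] guards against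
   [N = 0]. *)
assert (P : 0 < Rabs l / (2 * (N + 1))) by (apply Rdiv_lt_0_compat; lra).
generalize (filter_and _ _ (filter_and _ _ HN HM) (locally_0_lt _ P)).
apply filter_imp; intros s [[A B] D] x; specialize (A x); specialize (B x).
simpl in A; rewrite Rmult_1_r in A.
assert (A' : Rabs (g s - l) <= Rabs l / 2).
{ eapply Rle_trans; [apply A|].
  apply Rle_trans with ((N + 1) * (Rabs l / (2 * (N + 1)))); [|right; field; lra].
  pose proof (Rabs_pos s); apply Rmult_le_compat; lra. }
assert (G : Rabs l / 2 <= Rabs (g s)).
{ pose proof (Rabs_triang_inv l (l - g s)) as T.
  replace (l - (l - g s)) with (g s) in T by ring.
  rewrite (Rabs_minus_sym l (g s)) in T; lra. }
rewrite Rabs_mult in B.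
apply Rmult_le_reg_l with (Rabs l / 2); [lra|].
apply Rle_trans with (M * Rabs s ^ n); [|right; field; lra].
eapply Rle_trans; [|apply B].
apply Rmult_le_compat_r; [apply Rabs_pos|assumption].
Qed.

Lemma bigO_monomial_0 (b : R) (n : nat) : bigO (fun s => s ^ n * b) (S n) -> b = 0.
Proof.
intros H; destruct (unif_O_pos _ _ H) as [M [M0 [d Hd]]].
apply NNPP; intros N; apply Rabs_pos_lt in N.
(* At this point [M * s <= |b| / 2], contradicting [|b| <= M * s]. *)
set (s := Rmin (d / 2) (Rabs b / (2 * (M + 1)))).
assert (S1 : 0 < Rabs b / (2 * (M + 1))) by (apply Rdiv_lt_0_compat; lra).
assert (S2 : 0 < s <= d / 2 /\ s <= Rabs b / (2 * (M + 1))).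
{ pose proof (cond_pos d); unfold s, Rmin; destruct Rle_dec; lra. }
assert (D : ball 0 d s).
{ change (Rabs (s - 0) < d); rewrite Rminus_0_r, Rabs_right; lra. }
specialize (Hd s D 0).
rewrite Rabs_mult, (Rabs_right (s ^ n)), (Rabs_right s) in Hd by (try apply Rle_ge, pow_le; lra).
simpl in Hd.
assert (P : 0 < s ^ n) by (apply pow_lt; lra).
assert (Q : Rabs b <= M * s).
{ apply Rmult_le_reg_l with (s ^ n); [assumption|]; lra. }
assert (M * s <= (M + 1) * (Rabs b / (2 * (M + 1)))).
{ apply Rmult_le_compat; lra. }
replace ((M + 1) * (Rabs b / (2 * (M + 1)))) with (Rabs b / 2) in H0 by (field; lra).
lra.
Qed.

(** Removing the top monomial costs one order, exactly what the induction hypothesis allows. *)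
Lemma bigO_polynomial_0 (b : nat -> R) (d : nat) :
  bigO (fun s => sum_n (fun j => s ^ j * b j) d) (S d) ->
  forall j, (j <= d)%nat -> b j = 0.
Proof.
induction d as [|d IH]; intros H.
- intros j Hj; replace j with 0%nat by lia.
  apply (bigO_monomial_0 _ 0); revert H; apply unif_O_ext; intros; now rewrite sum_O.
- assert (L : bigO (fun s => sum_n (fun j => s ^ j * b j) d) (S d)).
  { apply unif_O_ext with (fun s x => sum_n (fun j => s ^ j * b j) (S d)
      - s ^ S d * b (S d)).
    { intros; rewrite sum_n_S; ring. }
    apply unif_O_minus; [revert H; apply unif_O_weaken; lia|].
    apply (unif_O_monomial (fun _ => b (S d))).
    exists (Rabs (b (S d))); intros; lra. }
  specialize (IH L).
  intros j Hj; destruct (Nat.eq_dec j (S d)) as [->|N]; [|apply IH; lia].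
  apply (bigO_monomial_0 _ (S d)); revert H; apply unif_O_ext; intros s _.
  rewrite sum_n_S, sum_n_zero; [apply Rplus_0_l|].
  intros i Hi; rewrite IH by assumption; apply Rmult_0_r.
Qed.

(** The Taylor coefficients below [n] vanish by the order of [f], and the one at the odd index [n]
    vanishes by parity. *)
Lemma even_bigO_improve (f : R -> R) (a : nat -> R) (n : nat) :
  Nat.Odd n -> locally 0 (fun s => f (- s) = f s) ->
  bigO (fun s => f s - sum_n (fun j => s ^ j * a j) n) (S n) ->
  bigO f n -> bigO f (S n).
Proof.
intros Hn Ev T H.
assert (Q : bigO (fun s => sum_n (fun j => s ^ j * a j) (n - 1)) n).
{ apply unif_O_ext with (fun s x => f s - (f s - sum_n (fun j => s ^ j * a j) n)
    - s ^ n * a n).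
  { intros s _; destruct n as [|n]; [destruct Hn; lia|].
    rewrite sum_n_S; replace (S n - 1)%nat with n by lia; ring. }
  apply unif_O_minus; [apply unif_O_minus|].
  - assumption.
  - revert T; apply unif_O_weaken; lia.
  - apply (unif_O_monomial (fun _ => a n)); exists (Rabs (a n)); intros; lra. }
assert (Z : forall j, (j <= n - 1)%nat -> a j = 0).
{ apply bigO_polynomial_0; replace (S (n - 1)) with n by (destruct Hn; lia); assumption. }
assert (T' : bigO (fun s => f s - s ^ n * a n) (S n)).
{ revert T; apply unif_O_ext; intros s _; f_equal; f_equal.
  apply (sum_n_single (fun j => s ^ j * a j) n); [lia|].
  intros j Hj N; rewrite Z by lia; apply Rmult_0_r. }
assert (T'' : bigO (fun s => f (- s) - (- s) ^ n * a n) (S n)).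
{ destruct T' as [M [d Hd]]; exists M, d; intros s Hs x.
  rewrite <- (Rabs_Ropp s); apply (Hd (- s)); [|exact x].
  change (Rabs (- s - 0) < d); change (Rabs (s - 0) < d) in Hs.
  rewrite Rminus_0_r in *; now rewrite Rabs_Ropp. }
assert (A : a n = 0).
{ apply Rmult_eq_reg_l with (-2); [|lra]; rewrite Rmult_0_r.
  apply (bigO_monomial_0 _ n).
  apply unif_O_ext_loc with (2 := unif_O_minus _ _ _ T' T'').
  revert Ev; apply filter_imp; intros s E _; rewrite E.
  replace ((- s) ^ n) with (- s ^ n); [ring|].
  destruct Hn as [q ->].
  rewrite !pow_add, !pow_mult; replace ((- s) ^ 2) with (s ^ 2) by ring; ring. }
revert T'; apply unif_O_ext; intros s _; rewrite A; ring.
Qed.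

(** * The expansion of the curve *)

Lemma analytic_in_X_tail (beta eps : R) (phi : R -> R -> R) :
  0 < eps -> analytic_in_X beta eps phi ->
  exists a : nat -> R -> R, (forall j, in_X beta (a j)) /\
  forall d, exists M, locally 0 (fun s =>
    holder_bound beta (fun x => phi s x - sum_n (fun j => s ^ j * a j x) d)
      (M * Rabs s ^ S d)).
Proof.
intros He HA.
destruct (HA 0 ltac:(rewrite Rabs_R0; lra)) as [a [Ha [r [Hr H]]]].
exists a; split; [assumption|].
apply power_series_tail with (Rmin r eps).
- now apply Rmin_glb_lt.
- intros j; apply in_X_bound, Ha.
- intros s Hs e E.
  pose proof (Rmin_l r eps); pose proof (Rmin_r r eps).
  destruct (H s ltac:(rewrite Rminus_0_r; lra) ltac:(lra) e E) as [N HN].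
  exists N; intros n Hn; apply holder_norm_bound.
  specialize (HN n Hn); rewrite Rminus_0_r in HN; exact HN.
Qed.

(** The scalar series is viewed as a series of functions constant in [x], whose Hölder quotients
    vanish. *)
Lemma analytic_real_tail (eps : R) (c : R -> R) :
  0 < eps -> analytic_real eps c ->
  exists a : nat -> R, forall d,
    bigO (fun s => c s - sum_n (fun j => s ^ j * a j) d) (S d).
Proof.
intros He HA.
destruct (HA 0 ltac:(rewrite Rabs_R0; lra)) as [a [r [Hr H]]].
assert (K : forall u, holder_bound 1 (fun _ => u) (Rabs u)).
{ intros u; split; intros; [lra|].
  rewrite Rminus_diag, Rabs_R0; apply Rmult_le_pos; [apply Rabs_pos|].
  apply Rlt_le, Rpower_pos. }
exists a; intros d.
destruct (power_series_tail 1 (Rmin r eps) (fun s _ => c s) (fun j _ => a j))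
  with (d := d) as [M HM].
- now apply Rmin_glb_lt.
- intros j; exists (Rabs (a j)); apply K.
- intros s Hs e E.
  pose proof (Rmin_l r eps); pose proof (Rmin_r r eps).
  pose proof (H s ltac:(rewrite Rminus_0_r; lra) ltac:(lra)) as S.
  rewrite Rminus_0_r in S.
  destruct (proj1 (filterlim_locally _ _) S (mkposreal e E)) as [N HN].
  exists N; intros n Hn; specialize (HN n Hn).
  apply holder_bound_weaken with (2 := K _); apply Rlt_le.
  rewrite Rabs_minus_sym; erewrite sum_n_ext; [exact HN|].
  intros j; rewrite pow_n_pow; reflexivity.
- exists M; revert HM; apply filter_imp; intros s [B _]; exact B.
Qed.

Lemma mean_cos_coeff_0 (f : R -> R) : mean f = 0 -> cos_coeff 0 f = 0.
Proof.
unfold mean; intros H; pose proof PI_RGT_0 as Pi.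
apply Rmult_integral in H; destruct H as [H|H].
- exfalso; revert H; apply Rinv_neq_0_compat; lra.
- rewrite <- H; apply RInt_fun_ext; intros x.
  simpl; rewrite Rmult_0_l, cos_0; ring.
Qed.

Lemma is_inv_D_cos_coeff (alpha : R) (phi psi : R -> R) (m : nat) :
  is_inv_D alpha phi psi -> (1 <= m)%nat ->
  cos_coeff m psi = Rpower (INR m) (- alpha) * cos_coeff m phi.
Proof.
intros [_ _ _ H] Hm.
specialize (H (Z.of_nat m) ltac:(lia)).
apply (f_equal fst) in H; simpl in H; unfold mean in H.
rewrite Rmult_0_l, Rminus_0_r, Z.abs_eq, <- INR_IZR_INZ in H by lia.
pose proof PI_RGT_0 as Pi.
apply Rmult_eq_reg_l with (/ (2 * PI)); [|apply Rinv_neq_0_compat; lra].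
unfold cos_coeff; rewrite H; ring.
Qed.

Lemma steady_cos_coeff (alpha c : R) (n phi : R -> R) (m : nat) :
  continuous_fun phi -> continuous_fun (fun x => n (phi x)) ->
  steady_solution alpha n phi c -> (1 <= m)%nat ->
  (Rpower (INR m) (- alpha) - c) * cos_coeff m phi
    + cos_coeff m (fun x => n (phi x)) = 0.
Proof.
intros Cphi Cn [psi [D E]] Hm.
pose proof (is_inv_D_cos_coeff _ _ _ _ D Hm) as P.
destruct D as [Cpsi _ _ _].
(* The subtracted mean is a constant, invisible in the modes [m >= 1]. *)
assert (Z : cos_coeff m (fun _ => mean (fun y => n (phi y))) = 0).
{ rewrite (cos_coeff_ext m _ (fun x => mean (fun y => n (phi y)) * cos (INR 0 * x) ^ 0)).
  - rewrite cos_coeff_scal by apply continuous_fun_pow, continuous_fun_cos.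
    rewrite cos_coeff_pow, cos_pow_coeff_0; unfold full_period.
    destruct Z.eq_dec; [lia|ring].
  - intros x; simpl; ring. }
assert (S : cos_coeff m (fun x => psi x - c * phi x + n (phi x)
  - mean (fun y => n (phi y))) = 0).
{ rewrite (cos_coeff_ext m _ (fun x => 0 * phi x)).
  - rewrite cos_coeff_scal by assumption; ring.
  - intros x; rewrite E; ring. }
rewrite cos_coeff_minus, cos_coeff_plus, cos_coeff_minus, cos_coeff_scal, P, Z in S;
  auto using continuous_fun_plus, continuous_fun_minus, continuous_fun_mult,
    continuous_fun_const.
rewrite <- S; ring.
Qed.

Section expansion.
Variables (alpha beta : R) (p k : nat) (eps : R).
Variables (phi : R -> R -> R) (c : R -> R).
Hypothesis (alpha_in : 0 < alpha < 1).
Hypothesis (beta_in : Rmax alpha (1 / 2) < beta < 1).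
Hypothesis (p_ge2 : (2 <= p)%nat).
Hypothesis (k_ge1 : (1 <= k)%nat).
Hypothesis (eps_pos : 0 < eps).
Hypothesis (curve : bifurcation_curve alpha beta (fun x => x ^ p) k eps phi c).
Variable (a : nat -> R -> R).
Hypothesis (a_in_X : forall j, in_X beta (a j)).
Hypothesis (phi_tail : forall d, exists M, locally 0 (fun s =>
    holder_bound beta (fun x => phi s x - sum_n (fun j => s ^ j * a j x) d)
      (M * Rabs s ^ S d))).
Variable (cs : nat -> R).
Hypothesis (c_tail : forall d,
  bigO (fun s => c s - sum_n (fun j => s ^ j * cs j) d) (S d)).

Let kappa := Rpower (INR k) (- alpha).
Let cosk (x : R) := cos (INR k * x).
Let Phik := Phi alpha p k.

Lemma beta_pos : 0 < beta.
Proof. pose proof (Rmax_l alpha (1 / 2)); lra. Qed.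

Lemma near_eps : locally 0 (fun s => Rabs s < eps).
Proof. now apply locally_0_lt. Qed.

Lemma a_continuous (j : nat) : continuous_fun (a j).
Proof. exact (in_X_continuous beta _ beta_pos (a_in_X j)). Qed.

Lemma phi_continuous : locally 0 (fun s => continuous_fun (phi s)).
Proof.
generalize near_eps; apply filter_imp; intros s Hs.
exact (in_X_continuous beta _ beta_pos (curve_in_X _ _ _ _ _ _ _ curve s Hs)).
Qed.

Lemma cosk_continuous : continuous_fun cosk.
Proof. apply continuous_fun_cos. Qed.

Lemma cosk_bounded (n : nat) : exists M, forall x, Rabs (cosk x ^ n) <= M.
Proof.
exists 1; intros x; rewrite <- RPow_abs.
apply Rle_trans with (1 ^ n); [|rewrite pow1; lra].
apply pow_incr; split; [apply Rabs_pos|apply Rabs_le, COS_bound].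
Qed.

Lemma Phik_continuous : continuous_fun Phik.
Proof. apply Phi_continuous. Qed.

Lemma scal_cosk_unif_O : unif_O (fun s x => s * cosk x) 1.
Proof.
destruct (cosk_bounded 1) as [M HM].
apply unif_O_ext with (2 := unif_O_monomial cosk 1
  (ex_intro _ M (fun x => eq_ind _ (fun y => Rabs y <= M) (HM x) _ (pow_1 _)))).
intros; simpl; ring.
Qed.

Lemma phi_tail_unif (d : nat) :
  unif_O (fun s x => phi s x - sum_n (fun j => s ^ j * a j x) d) (S d).
Proof.
destruct (phi_tail d) as [M HM]; exists M.
revert HM; apply filter_imp; intros s [H _]; exact H.
Qed.

Lemma a_0 (x : R) : a 0%nat x = 0.
Proof.
destruct (phi_tail_unif 0) as [M H].
(* The bound is read at [s = 0] itself, where its right side is 0 and the sum is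
   [0 ^ 0 * a 0 x = a 0 x]. *)
apply locally_singleton in H; specialize (H x).
rewrite sum_O, (curve_phi_0 _ _ _ _ _ _ _ curve), Rabs_R0 in H; simpl in H.
rewrite Rmult_0_l, Rmult_0_r in H.
replace (0 - 1 * a 0%nat x) with (- a 0%nat x) in H by ring.
rewrite Rabs_Ropp in H.
pose proof (Rabs_pos (a 0%nat x)).
apply NNPP; intros N; apply Rabs_pos_lt in N; lra.
Qed.

Lemma phi_unif_O : unif_O phi 1.
Proof.
apply unif_O_ext with (2 := phi_tail_unif 0).
intros s x; rewrite sum_O, a_0; ring.
Qed.

Lemma c_near : bigO (fun s => c s - kappa) 1.
Proof.
assert (E : cs 0%nat = kappa).
{ destruct (c_tail 0) as [M H]; apply locally_singleton in H; specialize (H 0).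
  rewrite sum_O, (curve_c_0 _ _ _ _ _ _ _ curve), Rabs_R0 in H; simpl in H.
  fold kappa in H.
  rewrite Rmult_0_l, Rmult_0_r in H.
  pose proof (Rabs_pos (kappa - 1 * cs 0%nat)).
  apply NNPP; intros N.
  assert (N' : kappa - 1 * cs 0%nat <> 0) by lra.
  apply Rabs_pos_lt in N'; lra. }
apply unif_O_ext with (2 := c_tail 0).
intros s x; rewrite sum_O, E; simpl; ring.
Qed.

Lemma phi_coeff_eq (m : nat) : (1 <= m)%nat -> locally 0 (fun s =>
  (Rpower (INR m) (- alpha) - c s) * cos_coeff m (phi s)
    + cos_coeff m (fun x => phi s x ^ p) = 0).
Proof.
intros Hm; generalize (filter_and _ _ near_eps phi_continuous).
apply filter_imp; intros s [Hs Cs].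
apply (steady_cos_coeff alpha (c s) (fun x => x ^ p)); auto.
- now apply continuous_fun_pow.
- now apply (curve_solution _ _ _ _ _ _ _ curve).
Qed.

Lemma phi_coeff_k : locally 0 (fun s => cos_coeff k (phi s) = s * PI).
Proof.
generalize near_eps; apply filter_imp; intros s Hs.
pose proof (curve_coeff _ _ _ _ _ _ _ curve s Hs) as H.
pose proof PI_RGT_0.
apply Rmult_eq_reg_l with (/ PI); [|apply Rinv_neq_0_compat; lra].
unfold cos_coeff; rewrite H; apply Rminus_diag_uniq; field; lra.
Qed.

Lemma phi_coeff_0 : locally 0 (fun s => cos_coeff 0 (phi s) = 0).
Proof.
generalize near_eps; apply filter_imp; intros s Hs.
apply mean_cos_coeff_0, (in_X_mean beta), (curve_in_X _ _ _ _ _ _ _ curve s Hs).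
Qed.

(** The expected Taylor coefficients of [phi], written as a sequence to be compared with [a]; as
    [p >= 2], the two cases do not overlap. *)
Definition target (j : nat) (x : R) : R :=
  (if Nat.eq_dec j 1 then cosk x else 0) + (if Nat.eq_dec j p then Phik x else 0).

Lemma target_sum (d : nat) (s x : R) : (1 <= d)%nat ->
  sum_n (fun j => s ^ j * target j x) d
    = s * cosk x + (if le_dec p d then s ^ p * Phik x else 0).
Proof.
intros Hd.
rewrite (sum_n_ext _ (fun j =>
  plus (if Nat.eq_dec j 1 then s ^ j * cosk x else 0)
       (if Nat.eq_dec j p then s ^ j * Phik x else 0))).
2:{ intros j; change (plus ?u ?v) with (u + v); unfold target.
    destruct (Nat.eq_dec j 1), (Nat.eq_dec j p); apply Rminus_diag_uniq; ring. }
rewrite sum_n_plus; change (plus ?u ?v) with (u + v).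
f_equal.
- rewrite (sum_n_single _ 1 d Hd); [simpl; ring|].
  intros j _ N; now destruct Nat.eq_dec.
- destruct le_dec as [L|L].
  + rewrite (sum_n_single _ p d L); [now destruct Nat.eq_dec|].
    intros j _ N; now destruct Nat.eq_dec.
  + apply sum_n_zero; intros j Hj; destruct Nat.eq_dec; [lia|reflexivity].
Qed.

Lemma target_continuous (j : nat) : continuous_fun (target j).
Proof.
apply continuous_fun_plus; destruct Nat.eq_dec;
  auto using continuous_fun_const, cosk_continuous, Phik_continuous.
Qed.

Lemma target_even (j : nat) : even_fun (target j).
Proof.
intros x; unfold target, cosk, Phik.
now rewrite (cos_INR_even k x), (Phi_even_fun alpha p k x).
Qed.

Lemma target_periodic (j : nat) : periodic (2 * PI) (target j).
Proof.
intros x; unfold target, cosk, Phik.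
now rewrite (cos_INR_periodic k x), (Phi_periodic alpha p k x).
Qed.

(* Coefficientwise asymptotics determine the [X^beta]-valued power series. *)
Lemma phi_expansion (d : nat) :
  (forall m, bigO (fun s => cos_coeff m
    (fun x => phi s x - sum_n (fun j => s ^ j * target j x) d)) (S d)) ->
  exists M, locally 0 (fun s =>
    holder_bound beta (fun x => phi s x - sum_n (fun j => s ^ j * target j x) d)
      (M * Rabs s ^ S d)).
Proof.
intros H.
assert (CS : forall (u : nat -> R -> R) s, (forall j, continuous_fun (u j)) ->
  continuous_fun (fun x => sum_n (fun j => s ^ j * u j x) d)).
{ intros u s Hu; apply (continuous_fun_sum (fun j x => s ^ j * u j x)).
  intros j; apply continuous_fun_mult; [apply continuous_fun_const|apply Hu]. }
assert (E : forall j, (j <= d)%nat -> forall x, a j x - target j x = 0).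
{ intros j Hj; apply cos_coeff_unique.
  - apply continuous_fun_minus; [apply a_continuous|apply target_continuous].
  - intros x; rewrite (target_even j x), (in_X_even _ _ (a_in_X j) x); reflexivity.
  - intros x; rewrite (target_periodic j x), (in_X_periodic _ _ (a_in_X j) x); reflexivity.
  - intros m.
    apply (bigO_polynomial_0 (fun j => cos_coeff m (fun x => a j x - target j x)) d);
      [|assumption].
    assert (L : locally 0 (fun s =>
      continuous_fun (fun x => phi s x - sum_n (fun j => s ^ j * a j x) d))).
    { generalize phi_continuous; apply filter_imp; intros s Cs.
      apply continuous_fun_minus; [assumption|apply CS, a_continuous]. }
    (* The two expansions of the same coefficient differ by a polynomial in [s] of degree [d] that
       is [O(s^(d+1))]. *)
    apply unif_O_ext_loc with (2 := unif_O_minus _ _ _ (H m)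
      (bigO_cos_coeff _ m _ L (phi_tail_unif d))).
    generalize phi_continuous; apply filter_imp; intros s Cs _.
    rewrite <- cos_coeff_minus.
    + rewrite (cos_coeff_ext m _ (fun x => sum_n (fun j => s ^ j * (a j x - target j x)) d)).
      * rewrite (cos_coeff_sum m (fun j x => s ^ j * (a j x - target j x))).
        -- apply sum_n_ext; intros i; apply cos_coeff_scal.
           apply continuous_fun_minus; [apply a_continuous|apply target_continuous].
        -- intros i; apply continuous_fun_mult; [apply continuous_fun_const|].
           apply continuous_fun_minus; [apply a_continuous|apply target_continuous].
      * intros x.
        rewrite (sum_n_ext (fun j => s ^ j * (a j x - target j x))
          (fun j => s ^ j * a j x - s ^ j * target j x))
          by (intros i; apply Rmult_minus_distr_l).
        rewrite sum_n_Rminus; ring.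
    + apply continuous_fun_minus; [assumption|apply CS, target_continuous].
    + apply continuous_fun_minus; [assumption|apply CS, a_continuous]. }
destruct (phi_tail d) as [M HM]; exists M.
revert HM; apply filter_imp; intros s.
apply holder_bound_ext; intros x; f_equal.
apply sum_n_ext_loc; intros j Hj; f_equal.
apply Rminus_diag_uniq, E, Hj.
Qed.

Lemma coeff_m_gap (m : nat) : (1 <= m)%nat -> m <> k ->
  Rpower (INR m) (- alpha) - kappa <> 0.
Proof.
intros Hm N E; apply (Rpower_INR_neq alpha k m); try assumption; [lra|].
fold kappa; lra.
Qed.

(** The factor [m^-alpha - c] tends to a nonzero limit, so the coefficient inherits the order of
    [phi^p]. *)
Lemma phi_coeff_other (m : nat) : (1 <= m)%nat -> m <> k ->
  bigO (fun s => cos_coeff m (phi s)) p.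
Proof.
intros Hm N.
apply (bigO_div_near _ (fun s => Rpower (INR m) (- alpha) - c s)
  (Rpower (INR m) (- alpha) - kappa)).
- now apply coeff_m_gap.
- apply unif_O_ext with (2 := unif_O_scal (-1) _ _ c_near); intros; ring.
- assert (L : locally 0 (fun s => continuous_fun (fun x => phi s x ^ p))).
  { generalize phi_continuous; apply filter_imp; intros s.
    apply continuous_fun_pow. }
  apply unif_O_ext_loc with (2 := unif_O_scal (-1) _ _
    (bigO_cos_coeff _ m _ L (unif_O_pow _ p phi_unif_O))).
  generalize (phi_coeff_eq m Hm); apply filter_imp; intros s Hs _; lra.
Qed.

Lemma cos_coeff_cosk (m : nat) :
  cos_coeff m cosk = if Nat.eq_dec m k then PI else 0.
Proof. now apply cos_coeff_cos. Qed.

Lemma phi_expansion_1 : unif_O (fun s x => phi s x - s * cosk x) p.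
Proof.
destruct (phi_expansion (p - 1)) as [M HM].
- intros m.
  assert (E : locally 0 (fun s => cos_coeff m
     (fun x => phi s x - sum_n (fun j => s ^ j * target j x) (p - 1)) =
     cos_coeff m (phi s) - s * if Nat.eq_dec m k then PI else 0)).
  { generalize phi_continuous; apply filter_imp; intros s Cs.
    rewrite <- cos_coeff_cosk, <- cos_coeff_scal, <- cos_coeff_minus;
      auto using continuous_fun_mult, continuous_fun_const, cosk_continuous.
    apply cos_coeff_ext; intros x; rewrite target_sum by lia.
    destruct le_dec; [lia|ring]. }
  replace (S (p - 1)) with p by lia.
  (* Mode [k] is exact by the parametrisation and mode 0 by the zero mean; only the other modes
     carry an error. *)
  destruct (Nat.eq_dec m k) as [->|N].
  + apply unif_O_ext_loc with (fun _ _ => 0).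
    * generalize (filter_and _ _ E phi_coeff_k); apply filter_imp.
      intros s [-> ->] _; ring.
    * exists 0; apply filter_forall; intros; rewrite Rabs_R0, Rmult_0_l; lra.
  + destruct (Nat.eq_dec m 0) as [->|N0].
    * apply unif_O_ext_loc with (fun _ _ => 0).
      -- generalize (filter_and _ _ E phi_coeff_0); apply filter_imp.
         intros s [-> ->] _; ring.
      -- exists 0; apply filter_forall; intros; rewrite Rabs_R0, Rmult_0_l; lra.
    * apply unif_O_ext_loc with (2 := phi_coeff_other m ltac:(lia) N).
      revert E; apply filter_imp; intros s -> _; ring.
- exists M; revert HM; replace (S (p - 1)) with p by lia.
  apply filter_imp; intros s [H _] x; specialize (H x).
  rewrite target_sum in H by lia; destruct le_dec; [lia|].
  now rewrite Rplus_0_r in H.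
Qed.

Lemma cos_coeff_phi_pow (m : nat) :
  bigO (fun s => cos_coeff m (fun x => phi s x ^ p)
    - s ^ p * cos_coeff m (fun x => cosk x ^ p)) (2 * p - 1).
Proof.
assert (CP : continuous_fun (fun x => cosk x ^ p)).
{ apply continuous_fun_pow, cosk_continuous. }
assert (D : unif_O (fun s x => phi s x ^ p - s ^ p * cosk x ^ p) (2 * p - 1)).
{ pose proof (unif_O_pow_diff _ _ (p - 1) _ phi_unif_O scal_cosk_unif_O phi_expansion_1) as D.
  replace (S (p - 1)) with p in D by lia.
  replace (p - 1 + p)%nat with (2 * p - 1)%nat in D by lia.
  revert D; apply unif_O_ext; intros; now rewrite Rpow_mult_distr. }
apply unif_O_ext_loc with (2 := bigO_cos_coeff _ m _ (filter_imp _ _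
  (fun s Cs => continuous_fun_minus _ _ (continuous_fun_pow _ p Cs)
     (continuous_fun_mult _ _ (continuous_fun_const (s ^ p)) CP)) phi_continuous) D).
generalize phi_continuous; apply filter_imp; intros s Cs _.
rewrite cos_coeff_minus, cos_coeff_scal;
  auto using continuous_fun_mult, continuous_fun_const, continuous_fun_pow.
Qed.

(** In mode [k] the equation reads [(c - kappa) s PI = <phi^p, cos(kx)>], to be divided by
    [s PI]. *)
Lemma c_expansion :
  bigO (fun s => c s - (kappa + s ^ (p - 1) *
    (cos_coeff k (fun x => cosk x ^ p) / PI))) (2 * p - 2).
Proof.
pose proof PI_RGT_0 as Pi.
apply bigO_div_s.
- rewrite (curve_c_0 _ _ _ _ _ _ _ curve); fold kappa.
  rewrite pow_i by lia; ring.
- replace (S (2 * p - 2)) with (2 * p - 1)%nat by lia.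
  apply unif_O_ext_loc with (2 := unif_O_scal (/ PI) _ _ (cos_coeff_phi_pow k)).
  generalize (filter_and _ _ (phi_coeff_eq k k_ge1) phi_coeff_k).
  apply filter_imp; intros s [E K] _.
  fold kappa in E; rewrite K in E.
  rewrite (pow_pred s p) by lia.
  replace (cos_coeff k (fun x => phi s x ^ p)) with ((c s - kappa) * (s * PI)) by lra.
  field; lra.
Qed.

Lemma c_order : bigO (fun s => c s - kappa) (p - 1).
Proof.
apply unif_O_ext with (fun s x => c s - (kappa + s ^ (p - 1) *
    (cos_coeff k (fun x => cosk x ^ p) / PI)) +
    s ^ (p - 1) * (cos_coeff k (fun x => cosk x ^ p) / PI)).
{ intros; ring. }
apply unif_O_plus.
- apply unif_O_weaken with (2 := c_expansion); lia.
- apply (unif_O_monomial (fun _ => cos_coeff k (fun x => cosk x ^ p) / PI)).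
  eexists; intros; apply Rle_refl.
Qed.

(** Freezing [c] at [kappa] costs [(c - kappa) <phi, cos m>], of order [(p - 1) + p], the same as
    the error in [phi^p]. *)
Lemma phi_coeff_other_2 (m : nat) : (1 <= m)%nat -> m <> k ->
  bigO (fun s => cos_coeff m (phi s) - s ^ p * cos_coeff m Phik) (2 * p - 1).
Proof.
intros Hm N.
pose proof (coeff_m_gap m Hm N) as G.
pose proof (unif_O_mult _ _ _ _ c_order (phi_coeff_other m Hm N)) as Q.
replace (p - 1 + p)%nat with (2 * p - 1)%nat in Q by lia.
apply unif_O_ext_loc with (2 := unif_O_scal (/ (kappa - Rpower (INR m) (- alpha))) _ _
  (unif_O_minus _ _ _ (cos_coeff_phi_pow m) Q)).
generalize (phi_coeff_eq m Hm); apply filter_imp; intros s E _.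
pose proof (cos_coeff_Phi_eq alpha p k m ltac:(lra) p_ge2 k_ge1 Hm N) as P.
change (fun x => cos (INR k * x) ^ p) with (fun x => cosk x ^ p) in P.
fold kappa Phik in P; rewrite <- P.
replace (cos_coeff m (fun x => phi s x ^ p))
  with (- ((Rpower (INR m) (- alpha) - c s) * cos_coeff m (phi s))) by lra.
field; lra.
Qed.

Lemma phi_expansion_2 : exists M, locally 0 (fun s =>
  holder_bound beta (fun x => phi s x - (s * cosk x + s ^ p * Phik x))
    (M * Rabs s ^ (2 * p - 1))).
Proof.
(* Since [p >= 2], the index [p] is at most [2 * p - 2], so the sum contains the term [s^p Phi]. *)
destruct (phi_expansion (2 * p - 2)) as [M HM].
- intros m.
  assert (E : locally 0 (fun s => cos_coeff m
     (fun x => phi s x - sum_n (fun j => s ^ j * target j x) (2 * p - 2)) =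
     cos_coeff m (phi s) - (s * (if Nat.eq_dec m k then PI else 0)
       + s ^ p * cos_coeff m Phik))).
  { generalize phi_continuous; apply filter_imp; intros s Cs.
    rewrite <- cos_coeff_cosk, <- !cos_coeff_scal, <- cos_coeff_plus, <- cos_coeff_minus;
      auto using continuous_fun_plus, continuous_fun_mult, continuous_fun_const,
        cosk_continuous, Phik_continuous.
    apply cos_coeff_ext; intros x; rewrite target_sum by lia.
    destruct le_dec; [ring|lia]. }
  replace (S (2 * p - 2)) with (2 * p - 1)%nat by lia.
  destruct (Nat.eq_dec m k) as [->|N].
  + apply unif_O_ext_loc with (fun _ _ => 0).
    * generalize (filter_and _ _ E phi_coeff_k); apply filter_imp.
      intros s [-> ->] _; unfold Phik; rewrite cos_coeff_Phi_k by assumption; ring.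
    * exists 0; apply filter_forall; intros; rewrite Rabs_R0, Rmult_0_l; lra.
  + destruct (Nat.eq_dec m 0) as [->|N0].
    * apply unif_O_ext_loc with (fun _ _ => 0).
      -- generalize (filter_and _ _ E phi_coeff_0); apply filter_imp.
         intros s [-> ->] _; unfold Phik; rewrite cos_coeff_Phi_0 by assumption; ring.
      -- exists 0; apply filter_forall; intros; rewrite Rabs_R0, Rmult_0_l; lra.
    * apply unif_O_ext_loc with (2 := phi_coeff_other_2 m ltac:(lia) N).
      revert E; apply filter_imp; intros s -> _; ring.
- exists M; revert HM; replace (S (2 * p - 2)) with (2 * p - 1)%nat by lia.
  apply filter_imp; intros s; apply holder_bound_ext; intros x.
  rewrite target_sum by lia; destruct le_dec; [reflexivity|lia].
Qed.

(** The quadratic remainder has order [(p - 2) + 2p], and replacing [phi - s cos(kx)] by [s^p Phi]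
    in the linear term costs [(p - 1) + (2p - 1)]: both are [3p - 2]. *)
Lemma cos_coeff_phi_pow_even : Nat.Even p ->
  bigO (fun s => cos_coeff k (fun x => phi s x ^ p)
    - s ^ (2 * p - 1) * (PI * C_even alpha p k)) (3 * p - 2).
Proof.
intros Ev.
assert (CP : forall n, continuous_fun (fun x => cosk x ^ n)).
{ intros; apply continuous_fun_pow, cosk_continuous. }
assert (R1 : unif_O (fun s x => phi s x ^ p - (s * cosk x) ^ p
    - INR p * (s * cosk x) ^ (p - 1) * (phi s x - s * cosk x)) (3 * p - 2)).
{ pose proof (unif_O_pow_diff2 _ _ (p - 2) _ phi_unif_O scal_cosk_unif_O phi_expansion_1) as D.
  replace (S (S (p - 2))) with p in D by lia.
  replace (S (p - 2)) with (p - 1)%nat in D by lia.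
  replace (p - 2 + 2 * p)%nat with (3 * p - 2)%nat in D by lia.
  exact D. }
assert (R2 : unif_O (fun s x => INR p * ((s * cosk x) ^ (p - 1)
    * (phi s x - (s * cosk x + s ^ p * Phik x)))) (3 * p - 2)).
{ replace (3 * p - 2)%nat with (p - 1 + (2 * p - 1))%nat by lia.
  apply unif_O_scal, unif_O_mult; [apply unif_O_pow, scal_cosk_unif_O|].
  destruct phi_expansion_2 as [M HM]; exists M.
  revert HM; apply filter_imp; intros s [H _]; exact H. }
set (G := fun x => cosk x ^ (p - 1) * Phik x).
assert (CG : continuous_fun G).
{ apply continuous_fun_mult; [apply CP|apply Phik_continuous]. }
assert (R : unif_O (fun s x => phi s x ^ p - (s ^ p * cosk x ^ p
    + INR p * s ^ (2 * p - 1) * G x)) (3 * p - 2)).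
{ apply unif_O_ext with (2 := unif_O_plus _ _ _ R1 R2); intros s x; unfold G.
  replace (2 * p - 1)%nat with (p + (p - 1))%nat by lia.
  rewrite !Rpow_mult_distr, pow_add; ring. }
assert (CR : forall s, continuous_fun (fun x => s ^ p * cosk x ^ p
    + INR p * s ^ (2 * p - 1) * G x)).
{ intros s; auto using continuous_fun_plus, continuous_fun_mult, continuous_fun_const. }
apply unif_O_ext_loc with (2 := bigO_cos_coeff _ k _ (filter_imp _ _
  (fun s Cs => continuous_fun_minus _ _ (continuous_fun_pow _ p Cs) (CR s)) phi_continuous) R).
generalize phi_continuous; apply filter_imp; intros s Cs _.
rewrite cos_coeff_minus, cos_coeff_plus, !cos_coeff_scal;
  auto using continuous_fun_mult, continuous_fun_const, continuous_fun_pow.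
unfold cosk; rewrite cos_coeff_pow_even by assumption.
rewrite <- (cos_coeff_pow_Phi alpha p k) by assumption.
fold Phik; change (fun x => cos (INR k * x) ^ (p - 1) * Phik x) with G; ring.
Qed.

Lemma c_expansion_even : Nat.Even p ->
  bigO (fun s => c s - (kappa + s ^ (2 * p - 2) * C_even alpha p k)) (2 * p).
Proof.
intros Ev; pose proof PI_RGT_0 as Pi.
assert (H : bigO (fun s => c s - (kappa + s ^ (2 * p - 2) * C_even alpha p k)) (3 * p - 3)).
{ apply bigO_div_s.
  - rewrite (curve_c_0 _ _ _ _ _ _ _ curve); fold kappa.
    rewrite pow_i by lia; ring.
  - replace (S (3 * p - 3)) with (3 * p - 2)%nat by lia.
    apply unif_O_ext_loc with (2 := unif_O_scal (/ PI) _ _ (cos_coeff_phi_pow_even Ev)).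
    generalize (filter_and _ _ (phi_coeff_eq k k_ge1) phi_coeff_k).
    apply filter_imp; intros s [E K] _.
    fold kappa in E; rewrite K in E.
    rewrite (pow_pred s (2 * p - 1)) by lia.
    replace (2 * p - 1 - 1)%nat with (2 * p - 2)%nat by lia.
    replace (cos_coeff k (fun x => phi s x ^ p)) with ((c s - kappa) * (s * PI)) by lra.
    field; lra. }
destruct (le_lt_dec 3 p) as [L|L]; [revert H; apply unif_O_weaken; lia|].
(* For [p = 2] the remainder is only [O(s^3)], and evenness of [c] is needed. *)
assert (p2 : p = 2%nat) by lia; rewrite p2 in *; simpl (3 * 2 - 3)%nat in H.
(* For [p = 2] the subtracted polynomial is [kappa + s^2 C_even], so the Taylor coefficients of [c]
   change at the indices 0 and 2. *)
apply (even_bigO_improve _ (fun j => cs j - (if Nat.eq_dec j 0 then kappa else 0)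
  - (if Nat.eq_dec j 2 then C_even alpha 2 k else 0)) 3).
- now exists 1%nat.
- generalize near_eps; apply filter_imp; intros s Hs.
  rewrite (curve_c_even _ _ _ _ _ _ _ curve) by assumption.
  simpl; ring.
- apply unif_O_ext with (2 := c_tail 3); intros s _.
  rewrite !sum_n_S, !sum_O; simpl; ring.
- exact H.
Qed.

End expansion.

Theorem theorem4p4 :
  forall (alpha beta : R) (p k : nat) (eps : R)
         (phi : R -> R -> R) (c : R -> R),
    0 < alpha < 1 ->
    Rmax alpha (1 / 2) < beta < 1 ->
    (2 <= p)%nat ->
    (1 <= k)%nat ->
    0 < eps ->
    bifurcation_curve alpha beta (fun x => x ^ p) k eps phi c ->
    bigO_at_0 (fun s => holder_norm beta (fun x =>
        phi s x - (s * cos (INR k * x) + s ^ p * Phi alpha p k x)))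
      (2 * p - 1)
    /\ (Nat.Even p ->
        bigO_at_0 (fun s => Rabs (c s -
            (Rpower (INR k) (- alpha) + s ^ (2 * p - 2) * C_even alpha p k)))
          (2 * p))
    /\ (Nat.Odd p ->
        bigO_at_0 (fun s => Rabs (c s -
            (Rpower (INR k) (- alpha) + s ^ (p - 1) * C_odd p)))
          (2 * p - 2)).
Proof.
intros alpha beta p k eps phi c Ha Hb Hp Hk He curve.
destruct (analytic_in_X_tail _ _ _ He (curve_phi_analytic _ _ _ _ _ _ _ curve))
  as [a [a_in_X phi_tail]].
destruct (analytic_real_tail _ _ He (curve_c_analytic _ _ _ _ _ _ _ curve))
  as [cs c_tail].
split; [|split].
- destruct (phi_expansion_2 alpha beta p k eps phi c Ha Hb Hp Hk He curve
    a a_in_X phi_tail cs c_tail) as [M HM].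
  exists (2 * M); revert HM; apply filter_imp; intros s H.
  rewrite Rmult_assoc; now apply holder_norm_le.
- intros Ev.
  destruct (c_expansion_even alpha beta p k eps phi c Ha Hb Hp Hk He curve
    a a_in_X phi_tail cs c_tail Ev) as [M HM].
  exists M; revert HM; apply filter_imp; intros s H; exact (H 0).
- intros Od.
  destruct (c_expansion alpha beta p k eps phi c Ha Hb Hp Hk He curve
    a a_in_X phi_tail cs c_tail) as [M HM].
  exists M; revert HM; apply filter_imp; intros s H; specialize (H 0).
  rewrite cos_coeff_pow_odd in H by assumption.
  pose proof PI_RGT_0.
  replace (PI * C_odd p / PI) with (C_odd p) in H by (field; lra).
  exact H.
Qed.
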